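(* Let $B=(X,Y)$ be a planar Brownian motion, let $a<b$ be times in its time domain, and let $\mathcal{A}_{[a,b)}$ be the Lévy area of $B$ over $[a,b)$. Then the nonzero moments of $\mathcal{A}_{[a,b)}$ are exactly those of even order, and they are given by $$\mathbb{E}\!\left[\left(\mathcal{A}_{[a,b)}\right)^{2m}\right]=\left(\frac{b-a}{2}\right)^{2m}A_{2m}\qquad (m=0,1,2,\dots),$$ where $A_{2m}$ is the Euler zigzag number of index $2m$. (The moments of odd order are zero.)
   Context: A planar Brownian motion $B=(X,Y)$ has components $X$ and $Y$ that are independent one-dimensional (standard) Brownian motions. The Lévy area of $B$ over the time interval $[a,b)$ is the (Itô) stochastic integral $$\mathcal{A}_{[a,b)}=\frac12\int_a^b\Bigl((X-X(a))\,dY-(Y-Y(a))\,dX\Bigr).$$ The Euler zigzag number $A_n$ is the number of zigzag permutations in the symmetric group $S_n$, i.e. of permutations $s$ of $\{1,\dots,n\}$ with $s(1)>s(2)<s(3)>s(4)<\cdots$; by convention $A_0=1$. (Equivalently, $\operatorname{sech}(z)=\sum_{m\ge 0}(-1)^m\frac{A_{2m}}{(2m)!}z^{2m}$.) *)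

(* Defs.v *)
From HB Require Import structures.
From mathcomp Require Import all_boot all_order all_algebra all_fingroup.
From mathcomp Require Import all_classical all_reals all_analysis.

Set Implicit Arguments.
Unset Strict Implicit.
Unset Printing Implicit Defensive.

Import Order.TTheory GRing.Theory Num.Theory.
Import numFieldNormedType.Exports.

Local Open Scope classical_set_scope.
Local Open Scope ring_scope.

(* The entries 1, ..., n of a permutation are shifted to 0, ..., n.-1, so the
   descents required after the 1st, 3rd, ... entries sit at even i. *)
Definition zigzag (n : nat) (s : 'S_n) : bool :=
  [forall i : 'I_n, forall j : 'I_n, (j == i.+1 :> nat) ==>
    if odd i then (s i < s j)%N else (s j < s i)%N].

Definition euler_zigzag (n : nat) : nat := #|[set s : 'S_n | zigzag s]%SET|.

(* The smallest sigma-algebra making every X i with i in D measurable. *)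
Definition sigma_gen (I T : Type) (R : realType) (D : set I)
    (X : I -> T -> R) : set (set T) :=
  <<s \bigcup_(i in D) preimage_set_system setT (X i) measurable >>.

Definition indep (d : measure_display) (T : measurableType d) (R : realType)
    (P : probability T R) (F G : set (set T)) : Prop :=
  forall A B, F A -> G B -> P (A `&` B) = (P A * P B)%E.

(* Time domains [0, t], [0, t) (t > 0), [0, +oo), and the degenerate {0}. *)
Definition time_domain (R : realType) (D : set R) : Prop :=
  [/\ is_interval D, D 0 & D `<=` `[0, +oo[].

(* normal_prob takes a mean and a standard deviation. *)
Record brownian_motion (d : measure_display) (T : measurableType d)
    (R : realType) (P : probability T R) (D : set R)
    (W : R -> {RV P >-> R}) : Prop := {
  bm_start : {ae P, forall w, W 0 w = 0} ;
  bm_indep_incr : forall s t, D s -> D t -> s < t ->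
    indep P (sigma_gen [set tt] (fun _ w => W t w - W s w))
            (sigma_gen (D `&` `]-oo, s]) W) ;
  bm_normal_incr : forall s t, D s -> D t -> s < t ->
    forall B : set R, measurable B ->
      P [set w | B (W t w - W s w)] = normal_prob 0 (Num.sqrt (t - s)) B ;
  bm_continuous :
    {ae P, forall w, {within D, continuous (fun t => W t w)}} }.

Record planar_brownian_motion (d : measure_display) (T : measurableType d)
    (R : realType) (P : probability T R) (D : set R)
    (X Y : R -> {RV P >-> R}) : Prop := {
  pbm_fst : brownian_motion D X ;
  pbm_snd : brownian_motion D Y ;
  pbm_indep : indep P (sigma_gen D X) (sigma_gen D Y) }.

Definition planar_filtration (R : realType) (T : Type) (D : set R)
    (X Y : R -> T -> R) (t : R) : set (set T) :=
  <<s sigma_gen (D `&` `]-oo, t]) X `|` sigma_gen (D `&` `]-oo, t]) Y >>.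

(* Data of the process equal to coef k on [knot k, knot k.+1) for k < steps;
   only the values knot 0, ..., knot steps and coef 0, ..., coef steps.-1
   matter. *)
Record step_process (R T : Type) := StepProcess {
  steps : nat ;
  knot : nat -> R ;
  coef : nat -> T -> R }.

Definition step_val (T : Type) (R : realType) (phi : step_process R T)
    (t : R) (w : T) : R :=
  \sum_(k < steps phi) coef phi k w * \1_`[knot phi k, knot phi k.+1[ t.

Definition step_integral (T : Type) (R : realType) (W : R -> T -> R)
    (phi : step_process R T) (w : T) : R :=
  \sum_(k < steps phi) coef phi k w * (W (knot phi k.+1) w - W (knot phi k) w).

(* Elementary integrands over [a, b): adapted to the filtration F and
   square-integrable. *)
Record elementary (d : measure_display) (T : measurableType d)
    (R : realType) (P : probability T R) (F : R -> set (set T)) (a b : R)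
    (phi : step_process R T) : Prop := {
  elem_first : knot phi 0%N = a ;
  elem_last : knot phi (steps phi) = b ;
  elem_lt : forall k, (k < steps phi)%N -> knot phi k < knot phi k.+1 ;
  elem_adapted : forall k, (k < steps phi)%N ->
    forall B : set R, measurable B -> F (knot phi k) (coef phi k @^-1` B) ;
  elem_L2 : forall k, (k < steps phi)%N ->
    ('E_P[(fun w => (coef phi k w ^+ 2)%R)] < +oo)%E }.

(* I is a version of the Ito integral of H against W over [a, b): the limit in
   L^2(P) of the integrals of elementary integrands converging to H in
   L^2([a, b) x Omega).  It is determined up to P-null sets, so completing F
   would not change this relation. *)
Definition is_ito_integral (d : measure_display) (T : measurableType d)
    (R : realType) (P : probability T R) (F : R -> set (set T))
    (W : R -> T -> R) (a b : R) (H : R -> T -> R) (I : {RV P >-> R}) : Prop :=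
  exists phi : nat -> step_process R T,
    [/\ forall n, elementary P F a b (phi n),
        (\int[lebesgue_measure]_(t in `[a, b[)
            'E_P[(fun w => ((step_val (phi n) t w - H t w) ^+ 2)%R)])%E
          @[n --> \oo] --> 0%E
      & 'E_P[(fun w => ((step_integral W (phi n) w - I w) ^+ 2)%R)]%E
          @[n --> \oo] --> 0%E].

Definition is_levy_area (d : measure_display) (T : measurableType d)
    (R : realType) (P : probability T R) (D : set R)
    (X Y : R -> {RV P >-> R}) (a b : R) (A : {RV P >-> R}) : Prop :=
  exists IXdY IYdX : {RV P >-> R},
    [/\ is_ito_integral (planar_filtration D X Y) Y a b
          (fun t w => X t w - X a w) IXdY,
        is_ito_integral (planar_filtration D X Y) X a b
          (fun t w => Y t w - Y a w) IYdX
      & {ae P, forall w, A w = 2^-1 * (IXdY w - IYdX w)}].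

(* Main.v *)
Require Import Defs.
From HB Require Import structures.
From mathcomp Require Import all_boot all_order all_algebra all_fingroup.
From mathcomp Require Import all_classical all_reals all_analysis.
From mathcomp Require Import measurable_realfun.
From mathcomp Require Import ring lra zify.

Set Implicit Arguments.
Unset Strict Implicit.
Unset Printing Implicit Defensive.

Import Order.TTheory GRing.Theory Num.Theory.
Import numFieldNormedType.Exports.

Local Open Scope classical_set_scope.
Local Open Scope ring_scope.


(** Let the planar Brownian motion be sampled at the knots of a uniform partition
    of [a, b[ into N steps of length dt, and let A_k and R_k be the discrete Lévy
    area and the distance to the starting point after k steps.  Integrating out
    the last increments of Y and of X means completing a square twice, and turns
    E exp (z A_(k+1) + c R_(k+1)^2) into a multiple of
    E exp (z A_k + c' R_k^2) ([expectation_area_step]).  The map from c to c' is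
    homographic; writing c = (z / 4) (s / q) makes it the linear recursion of
    q + i s = (1 + i z dt / 2)^j, the prefactors telescope, and
      E exp (z A_N) = 1 / Re ((1 + i z dt / 2)^N)
    for small z ([expectation_exp_area], [mgf_discrete_area]).  The denominator is
    a polynomial in z, so comparing Taylor coefficients at 0 gives one linear
    relation for each moment of A_N ([discrete_area_moments]).

    The discrete areas converge to the Lévy area in L2.  An Itô integral of
    H = X - X(a) is a limit of integrals of arbitrary elementary integrands phi.
    If phi takes the value c_k on a step starting at t_k, then for t in this step
      E (phi(t) - H(t))^2 = E (c_k - H(t_k))^2 + (t - t_k),
    because the increment of X after t_k is independent of the past.  Hence
    convergence of phi to H forces the quadratic size of the partition to vanish,
    and by the isometry forces the integral of phi to be close to the Riemann sum
    with the same knots ([elementary_bounds]).  Riemann sums with different knots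
    are compared through the covariance min (s, t) of Brownian motion
    ([riemann_distance]).  So the uniform Riemann sums converge, at an explicit
    rate, to any version of the integral ([ito_riemann_distance]).

    The formula for E exp (z A_N) bounds the exponential moments of A_N uniformly
    in N; together with convergence in L2 this gives convergence of all moments
    ([expectation_exp_limit], [mean_pow_limit]).  As N grows, the coefficients of
    Re ((1 + i z (b - a) / 2N)^N) tend to those of cos (z (b - a) / 2), so the
    series of the E[A^n] / n! is the formal inverse of this cosine.

    Finally the zigzag numbers of even index, with the same powers of (b - a) / 2,
    are the coefficients of that inverse.  Sorting zigzag permutations by their
    first entry gives a difference table ([entringer_step]); with suitable signs
    it is the table of differences of a single sequence, and binomial inversion
    along its first column is the identity sech * cosh = 1 ([sech_cosh]). *)

(** * Zigzag permutations and the secant numbers *)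

Definition entringer (n i : nat) : nat :=
  #|[set s : 'S_n.+1 | zigzag s & s ord0 == i :> nat]%SET|.

(** Removing the first entry of a zigzag permutation leaves one with ascents and
    descents exchanged; reversing the order of the values restores the pattern. *)
Definition prepend_rev n (i : 'I_n.+2) (t : 'S_n.+1) : 'S_n.+2 :=
  lift_perm ord0 i (t * perm (@rev_ord_inj n.+1))%g.

Lemma prepend_rev0 n (i : 'I_n.+2) t : prepend_rev i t ord0 = i.
Proof. by rewrite /prepend_rev lift_perm_id. Qed.

Lemma prepend_rev_lift n (i : 'I_n.+2) t k :
  prepend_rev i t (lift ord0 k) = lift i (rev_ord (t k)).
Proof. by rewrite /prepend_rev lift_perm_lift permM permE. Qed.

Lemma prepend_rev_inj n (i : 'I_n.+2) : injective (prepend_rev i).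
Proof.
move=> t u e; apply/permP => k; apply: rev_ord_inj; apply: (@lift_inj _ i).
by rewrite -!prepend_rev_lift e.
Qed.

Lemma prepend_rev_surj n (s : 'S_n.+2) : exists t, prepend_rev (s ord0) t = s.
Proof.
have E k : s ord0 != s (lift ord0 k).
  by rewrite (inj_eq perm_inj) neq_lift.
pose g k : 'I_n.+1 := rev_ord (odflt ord0 (unlift (s ord0) (s (lift ord0 k)))).
have gE k : lift (s ord0) (rev_ord (g k)) = s (lift ord0 k).
  by rewrite /g rev_ordK; have [j -> -> /=] := unlift_some (E k).
have g_inj : injective g.
  move=> k l ekl; apply: (@lift_inj _ ord0); apply: (@perm_inj _ s).
  by rewrite -!gE ekl.
exists (perm g_inj); apply/permP => k.
have [j ->|->] := unliftP ord0 k; last by rewrite prepend_rev0.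
by rewrite prepend_rev_lift permE gE.
Qed.

Lemma zigzag_prepend_rev n (i : 'I_n.+2) (t : 'S_n.+1) :
  zigzag (prepend_rev i t) = (n - t ord0 < i)%N && zigzag t.
Proof.
have bumpE (x : 'I_n.+1) : bump i (rev_ord x) = ((i <= n - x) + (n - x))%N.
  by rewrite /bump /= subSS.
apply/idP/andP.
- move=> /forallP zs; split.
    have /implyP := forallP (zs ord0) (lift ord0 ord0).
    move=> /(_ (eqxx _)) /=; rewrite prepend_rev0 prepend_rev_lift /= bumpE.
    lia.
  apply/forallP => k; apply/forallP => l; apply/implyP => /eqP lk.
  have /implyP := forallP (zs (lift ord0 k)) (lift ord0 l).
  rewrite !prepend_rev_lift /= !bumpE => /(_ _).
  rewrite /bump /= !add1n lk eqxx => /(_ isT) /=.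
  have := ltn_ord (t k); have := ltn_ord (t l).
  have : (t k == t l :> nat) = (k == l :> nat).
    by rewrite !(inj_eq val_inj) (inj_eq perm_inj).
  case: (odd k) => /=; lia.
- move=> [t0 /forallP zt].
  apply/forallP => k; apply/forallP => l; apply/implyP => /eqP lk.
  have [l' lE|l0] := unliftP ord0 l; last by move: lk; rewrite l0.
  have vl : l = l'.+1 :> nat by rewrite lE.
  have [k' kE|k0] := unliftP ord0 k.
    have vk : k = k'.+1 :> nat by rewrite kE.
    have /implyP := forallP (zt k') l'.
    rewrite vk kE lE !prepend_rev_lift /= !bumpE => /(_ _).
    have -> : l' == k'.+1 :> nat by apply/eqP; lia.
    move=> /(_ isT).
    have := ltn_ord (t k'); have := ltn_ord (t l').
    case: (odd k') => /=; lia.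
  have l'0 : l' = ord0 by apply/val_inj => /=; move: lk; rewrite vl k0 => -[].
  rewrite lE k0 prepend_rev0 prepend_rev_lift l'0 /= bumpE; lia.
Qed.

Lemma entringerS_card n i : (i < n.+2)%N -> entringer n.+1 i =
  #|[set t : 'S_n.+1 | zigzag t & (n - t ord0 < i)%N]%SET|.
Proof.
move=> lti; rewrite -(card_imset _ (@prepend_rev_inj n (Ordinal lti))).
apply: eq_card => s; rewrite inE; apply/andP/imsetP => [[zs /eqP s0]|[t]].
  have [t ts] := prepend_rev_surj s; exists t; last first.
    by rewrite -ts; congr prepend_rev; apply/val_inj.
  by move: zs; rewrite inE -ts zigzag_prepend_rev s0 andbC.
by rewrite inE andbC => zt ->; rewrite zigzag_prepend_rev prepend_rev0 eqxx.
Qed.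

(** The boustrophedon rule of Seidel and Entringer: raising the first entry by one
    admits exactly one more value for the second entry. *)
Lemma entringer_step n i : (i <= n)%N ->
  entringer n.+1 i.+1 = (entringer n.+1 i + entringer n (n - i))%N.
Proof.
move=> le_in; rewrite !entringerS_card ?ltnS ?(leqW le_in) //.
rewrite -cardsUI addnC [X in (_ = X + _)%N](_ : _ = 0)%N ?add0n; last first.
  apply: eq_card0 => t; rewrite !inE; apply/negbTE/negP.
  by move=> /andP[/andP[_ ?] /andP[_ /eqP ?]]; lia.
apply: eq_card => t; rewrite !inE -andb_orr; congr andb.
have := ltn_ord (t ord0); lia.
Qed.

Lemma entringer_at0 n : entringer n.+1 0 = 0%N.
Proof.
by rewrite entringerS_card //; apply: eq_card0 => t; rewrite !inE andbF.
Qed.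

Lemma entringer_top n : entringer n.+1 n.+1 = euler_zigzag n.+1.
Proof.
rewrite entringerS_card //; apply: eq_card => t; rewrite !inE.
by rewrite (leq_ltn_trans (leq_subr _ _)) ?andbT.
Qed.

Lemma zigzag_small n (s : 'S_n) : (n <= 1)%N -> zigzag s.
Proof.
move=> n1; apply/forallP => i; apply/forallP => j; apply/implyP => /eqP ji.
by have := ltn_ord i; have := ltn_ord j; lia.
Qed.

Lemma entringer00 : entringer 0 0 = 1%N.
Proof.
rewrite -[RHS](card_Sn 1); apply: eq_card => s.
by rewrite !inE zigzag_small //= ord1 eqxx.
Qed.

Lemma euler_zigzag0 : euler_zigzag 0 = 1%N.
Proof.
by rewrite -[RHS](card_Sn 0); apply: eq_card => s; rewrite !inE zigzag_small.
Qed.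

Lemma entringer_topE n : entringer n n = euler_zigzag n.
Proof.
case: n => [|n]; first by rewrite entringer00 euler_zigzag0.
exact: entringer_top.
Qed.

(** The rows of [entringer] are nondecreasing, and each starts with 0 followed by
    the total of the row before it, so no row vanishes. *)
Lemma euler_zigzag_gt0 n : (0 < euler_zigzag n)%N.
Proof.
elim: n => [|n IH]; first by rewrite euler_zigzag0.
suff: forall i, (i <= n)%N -> (0 < entringer n.+1 i.+1)%N.
  by rewrite -entringer_topE; apply.
elim=> [|i IHi] lein.
  by rewrite entringer_step // entringer_at0 subn0 entringer_topE.
by rewrite entringer_step // addn_gt0 IHi // ltnW.
Qed.

(** The rows of the table of [entringer] are read alternately in both directions,
    so the entry sits at [p] or at [q] according to the parity of the row; the
    signs turn the boustrophedon rule into a rule without parity. *)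
Definition seidel (p q : nat) : int :=
  (-1) ^+ uphalf (p + q) * (entringer (p + q) (if odd (p + q) then q else p))%:Z.

Lemma seidel_step p q : seidel p q.+1 = seidel p.+1 q - seidel p q.
Proof.
rewrite /seidel addnS addSn.
have -> : uphalf (p + q).+1 = (uphalf (p + q) + odd (p + q).+1)%N by lia.
have E1 := @entringer_step (p + q) p (leq_addr _ _).
have E2 := @entringer_step (p + q) q (leq_addl _ _).
rewrite exprD /=; case: (odd (p + q)) => /=.
  by rewrite E1 addKn PoszD; ring.
by rewrite E2 addnK PoszD; ring.
Qed.

(** By [seidel_step] each unit added to [q] is a difference in [p], hence [n] of
    them are an [n]-th difference. *)
Lemma seidel_binomial n p q :
  seidel p (q + n) = \sum_(k < n.+1) (-1) ^+ (n - k) * 'C(n, k)%:Z * seidel (p + k) q.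
Proof.
elim: n p => [|n IH] p.
  by rewrite big_ord1 !addn0 subnn bin0 !mul1r.
rewrite addnS seidel_step !IH.
rewrite [RHS]big_ord_recl /= subn0 bin0 addn0.
under [X in _ = _ + X]eq_bigr => k _ do
  rewrite /bump /= add1n subSS binS PoszD mulrDr mulrDl addnS -addSn.
rewrite big_split /= [RHS]addrA [RHS]addrC; congr (_ + _).
rewrite big_ord_recl /= subn0 bin0 addn0 opprD exprS !mulN1r !mulNr.
rewrite [X in _ = _ + X]big_ord_recr /= subnn bin_small // mulr0 mul0r addr0.
congr (_ + _); rewrite -sumrN; apply: eq_bigr => k _.
rewrite /bump /= add1n addSnnS -mulNr -mulNr; congr (_ * _ * _).
by rewrite -mulN1r -exprS -subSn.
Qed.

Definition sech_coef (k : nat) : int :=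
  if odd k then 0 else (-1) ^+ k./2 * (euler_zigzag k)%:Z.

(** The edge [q = 0] of the table holds the signed zigzag numbers at even places
    and zeros at odd places, while the edge [p = 0] vanishes at even places beyond
    the corner; the binomial formula relates the two edges. *)
Lemma sech_cosh n : ~~ odd n ->
  \sum_(k < n.+1) 'C(n, k)%:Z * sech_coef k = (n == 0%N)%:Z.
Proof.
move=> evn; have := seidel_binomial n 0 0.
rewrite /seidel add0n !add0n (negbTE evn).
have -> : (-1) ^+ uphalf n * (entringer n 0)%:Z = (n == 0%N)%:Z :> int.
  case: (n) => [|n']; first by rewrite entringer00 mulr1.
  by rewrite entringer_at0 mulr0.
move=> ->; apply: eq_bigr => -[k /=]; rewrite ltnS => lekn _.
rewrite add0n addn0 /sech_coef; case: (boolP (odd k)) => [odk|evk].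
  by case: (k) odk => // k' _; rewrite entringer_at0 !mulr0.
rewrite entringer_topE uphalf_half (negbTE evk) add0n.
have -> : (-1) ^+ (n - k) = 1 :> int.
  by rewrite -signr_odd oddB // (negbTE evk) (negbTE evn).
by rewrite mul1r.
Qed.

(** * Independent variables and Gaussian integrals *)

Section independence.
Context {R : realType} {d : measure_display} {T : measurableType d}.
Variable P : probability T R.

Definition indep_rv {d1 d2} {S1 : measurableType d1} {S2 : measurableType d2}
    (U : T -> S1) (V : T -> S2) := forall A B, measurable A -> measurable B ->
  P (U @^-1` A `&` V @^-1` B) = (P (U @^-1` A) * P (V @^-1` B))%E.

(** The joint law is the product of the laws, so the second variable may be
    replaced by an independent copy and Tonelli's theorem applies. *)
Lemma ge0_integral_indep {d1 d2} {S1 : measurableType d1}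
    {S2 : measurableType d2} (U : T -> S1) (V : T -> S2)
    (g : S1 * S2 -> \bar R) :
  measurable_fun setT U -> measurable_fun setT V -> indep_rv U V ->
  measurable_fun setT g -> (forall x, 0 <= g x)%E ->
  (\int[P]_w g (U w, V w) = \int[P]_w \int[P]_w' g (U w, V w'))%E.
Proof.
move=> mU mV UV mg g0.
pose U' : {mfun T >-> S1} := mfun_Sub (mem_set mU).
pose V' : {mfun T >-> S2} := mfun_Sub (mem_set mV).
have mW : measurable_fun setT (fun w => (U w, V w)).
  exact: measurable_fun_pair.
pose W' : {mfun T >-> (S1 * S2)%type} := mfun_Sub (mem_set mW).
transitivity (\int[distribution P U' \x distribution P V']_z g z)%E.
  rewrite -(ge0_integral_distribution W' mg g0).
  apply: eq_measure_integral => A mA _; apply/esym.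
  by apply: product_measure_unique => // B C mB mC; exact: UV.
rewrite fubini_tonelli1 //.
rewrite (ge0_integral_distribution U') //=; last 2 first.
- exact: measurable_fun_fubini_tonelli_F.
- by move=> y; exact: integral_ge0.
apply: eq_integral => w _; rewrite /fubini_F /=.
rewrite (ge0_integral_distribution V') //=.
exact: measurableT_comp.
Qed.

Lemma ge0_expectation_indepM (U V : T -> R) :
  measurable_fun setT U -> measurable_fun setT V -> indep_rv U V ->
  (forall w, 0 <= U w) -> (forall w, 0 <= V w) ->
  ('E_P[(fun w => U w * V w)%R] = 'E_P[U] * 'E_P[V])%E.
Proof.
move=> mU mV UV U0 V0; rewrite !unlock.
pose g (z : R * R) : \bar R := (`|z.1| * `|z.2|)%:E.
have mg : measurable_fun setT g.
  apply/measurable_EFinP; apply: measurable_funM; apply: measurableT_comp => //.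
transitivity (\int[P]_w g (U w, V w))%E.
  by apply: eq_integral => w _; rewrite /g /= !ger0_norm.
rewrite (ge0_integral_indep mU mV UV mg); last by move=> x; rewrite lee_fin mulr_ge0.
transitivity (\int[P]_w ((U w)%:E * \int[P]_w' (V w')%:E))%E.
  apply: eq_integral => w _; rewrite -ge0_integralZl ?lee_fin //.
  - by apply: eq_integral => w' _; rewrite /g /= !ger0_norm.
  - exact/measurable_EFinP.
  - by move=> x _; rewrite lee_fin.
rewrite ge0_integralZr //.
- exact/measurable_EFinP.
- by move=> x _; rewrite lee_fin.
- by apply: integral_ge0 => x _; rewrite lee_fin.
Qed.

End independence.

Section density.
Context {R : realType} {d : measure_display} {X : measurableType d}.
Variables (mu nu : {measure set X -> \bar R}) (p : X -> R).
Hypothesis mp : measurable_fun setT p.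
Hypothesis p0 : forall x, 0 <= p x.
Hypothesis nuE : forall A, measurable A -> nu A = (\int[mu]_(x in A) (p x)%:E)%E.
Import HBNNSimple.

Lemma ge0_integral_density (g : X -> R) :
  measurable_fun setT g -> (forall x, 0 <= g x) ->
  (\int[nu]_x (g x)%:E = \int[mu]_x (g x * p x)%:E)%E.
Proof.
move=> mg g0.
have mgE : measurable_fun setT (EFin \o g) by exact/measurable_EFinP.
pose g_ := nnsfun_approx measurableT mgE.
have cvg_g x : (g_ n x)%:E @[n --> \oo] --> (g x)%:E.
  by apply: cvg_nnsfun_approx => // *; rewrite lee_fin.
have ndg x a b : (a <= b)%N -> g_ a x <= g_ b x.
  by move=> ab; exact/lefP/nd_nnsfun_approx.
transitivity (limn (fun n => \int[nu]_x (g_ n x)%:E))%E.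
  rewrite -monotone_convergence //.
  - by apply: eq_integral => x _; apply/esym/cvg_lim => //; exact: cvg_g.
  - by move=> n; exact/measurable_EFinP.
  - by move=> n x _; rewrite lee_fin.
  - by move=> x _ a b ab; rewrite lee_fin ndg.
rewrite [X in limn X](_ : _ =
    (fun n => \int[mu]_x (g_ n x * p x)%:E))%E.
  rewrite -monotone_convergence //.
  - apply: eq_integral => x _; apply/cvg_lim => //.
    under eq_fun do rewrite EFinM.
    by rewrite EFinM; apply: cvgeZr => //; exact: cvg_g.
  - by move=> n; apply/measurable_EFinP; exact: measurable_funM.
  - by move=> n x _; rewrite lee_fin mulr_ge0.
  - by move=> x _ a b ab; rewrite lee_fin ler_wpM2r // ndg.
apply/funext => n.
under eq_integral do rewrite fimfunE -fsumEFin //.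
rewrite ge0_integral_fsum //; last 2 first.
- by move=> y; exact/measurable_EFinP/measurable_funM.
- by move=> y x _; rewrite nnfun_muleindic_ge0.
under [RHS]eq_integral do rewrite fimfunE mulr_fsuml -fsumEFin //.
rewrite ge0_integral_fsum //; last 2 first.
- move=> y; apply/measurable_EFinP; apply: measurable_funM => //.
  exact: measurable_funM.
- by move=> y x _; rewrite !EFinM mule_ge0 ?nnfun_muleindic_ge0 // lee_fin.
apply: eq_fsbigr => r /set_mem [w _ rE].
have r0 : 0 <= r by rewrite -rE.
have mr : measurable (g_ n @^-1` [set r]) by [].
rewrite integralZl_indic_nnsfun //.
rewrite integral_indic // setIT nuE // integral_mkcond -ge0_integralZl //.
- apply: eq_integral => x _; rewrite patchE indicE.
  by case: (x \in _); rewrite ?mulr1 ?mulr0 ?mul0r ?mule0.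
- by apply/(measurable_restrictT _ _).1 => //; apply/measurable_EFinP/measurable_funTS.
- by move=> x _; rewrite patchE; case: ifP => _; rewrite ?lee_fin.
Qed.
End density.

Section normal_integral.
Context {R : realType}.
Notation mu := (@lebesgue_measure R).

Lemma ge0_integral_normal_prob (m s : R) (g : R -> R) :
  measurable_fun setT g -> (forall x, 0 <= g x) ->
  (\int[normal_prob m s]_x (g x)%:E =
   \int[mu]_x (g x * normal_pdf m s x)%:E)%E.
Proof.
move=> mg g0; apply: ge0_integral_density => //.
- exact: measurable_normal_pdf.
- exact: normal_pdf_ge0.
Qed.

(** Completing the square: tilting a centred normal density by a Gaussian factor
    gives a multiple of another normal density. *)
Lemma integral_normal_exp_quadratic (v al be : R) : 0 < v -> be * v < 1 ->
  (\int[normal_prob 0 (Num.sqrt v)]_x (expR (al * x + be / 2 * x ^+ 2))%:E =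
   ((Num.sqrt (1 - be * v))^-1 * expR (al ^+ 2 * v / (2 * (1 - be * v))))%:E)%E.
Proof.
move=> v0 bv; rewrite ge0_integral_normal_prob; last 2 first.
- apply: measurableT_comp => //; apply: measurable_funD; apply: measurable_funM => //.
- by move=> x; exact: expR_ge0.
have k0 : 0 < 1 - be * v by rewrite subr_gt0.
set c := (X in X%:E).
pose v' := v / (1 - be * v); pose m' := al * v'.
have v'0 : 0 < v' by rewrite divr_gt0.
have sv : Num.sqrt v != 0 by rewrite gt_eqF // sqrtr_gt0.
have sv' : Num.sqrt v' != 0 by rewrite gt_eqF // sqrtr_gt0.
transitivity (\int[mu]_x (c%:E * (normal_pdf m' (Num.sqrt v') x)%:E))%E.
  apply: eq_integral => x _; rewrite -EFinM; congr EFin.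
  rewrite !normal_pdfE // /normal_fun /normal_peak.
  rewrite !sqr_sqrtr ?ltW // subr0 /c.
  have -> : (Num.sqrt (v' * pi *+ 2))^-1 =
            (Num.sqrt (v * pi *+ 2))^-1 * Num.sqrt (1 - be * v).
    have -> : v' * pi *+ 2 = v * pi *+ 2 * (1 - be * v)^-1.
      by rewrite /v' -mulrnAr -mulrnAr; ring.
    rewrite sqrtrM; last by rewrite mulrn_wge0 // mulr_ge0 ?pi_ge0 // ltW.
    by rewrite sqrtrV ?ltW // invfM invrK.
  have s0 : Num.sqrt (1 - be * v) != 0 by rewrite gt_eqF // sqrtr_gt0.
  rewrite [RHS](_ : _ = (Num.sqrt (v * pi *+ 2))^-1 *
    (expR (al ^+ 2 * v / (2 * (1 - be * v))) *
     expR (- (x - m') ^+ 2 / (v' *+ 2)))); last first.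
    move: (Num.sqrt (v * pi *+ 2))^-1 (expR _) (expR _) s0.
    by move: (Num.sqrt (1 - _)) => q pk e1 e2 q0; field.
  rewrite mulrCA; congr (_ * _); rewrite -!expRD; congr expR.
  rewrite /m' /v'; field.
  by rewrite (gt_eqF v0) (gt_eqF k0).
rewrite ge0_integralZl //.
- by rewrite integral_normal_pdf mule1.
- by apply/measurable_EFinP; exact: measurable_normal_pdf.
- by move=> x _; rewrite lee_fin normal_pdf_ge0.
- by rewrite lee_fin mulr_ge0 ?expR_ge0 // invr_ge0.
Qed.

End normal_integral.

(** * Integrable and square-integrable random variables *)

Section integrability.
Context {R : realType} {d : measure_display} {T : measurableType d}.
Variable P : probability T R.
Implicit Types f g : T -> R.

(** Membership in L1 and L2 is spelled out as a plain proposition on functions,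
    so that it can be proved for explicit expressions. *)
Definition L1 f := P.-integrable setT (EFin \o f).

Definition L2 f := measurable_fun setT f /\ L1 (fun w => f w ^+ 2).

Definition mean f : R := (\int[P]_w f w)%R.

Lemma L1_measurable f : L1 f -> measurable_fun setT f.
Proof. by move=> /integrableP[/measurable_EFinP]. Qed.

Lemma expectation_mean f : L1 f -> ('E_P[f] = (mean f)%:E)%E.
Proof. by move=> f1; rewrite unlock /mean /Rintegral fineK // integrable_fin_num. Qed.

Lemma mean_expectation f (r : R) : ('E_P[f] = r%:E)%E -> mean f = r.
Proof. by rewrite unlock /mean /Rintegral => ->. Qed.

Lemma L1_cst (r : R) : L1 (fun=> r).
Proof. exact: finite_measure_integrable_cst. Qed.

Lemma L1D f g : L1 f -> L1 g -> L1 (fun w => f w + g w).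
Proof. by move=> f1 g1; have := integrableD measurableT f1 g1. Qed.

Lemma L1Z (k : R) f : L1 f -> L1 (fun w => k * f w).
Proof. by move=> f1; have := integrableZl measurableT k f1. Qed.

Lemma L1B f g : L1 f -> L1 g -> L1 (fun w => f w - g w).
Proof. by move=> f1 g1; have := integrableB measurableT f1 g1. Qed.

Lemma L1_sum n (f : 'I_n -> T -> R) : (forall i, L1 (f i)) ->
  L1 (fun w => \sum_(i < n) f i w).
Proof.
elim: n f => [|n IH] f f1.
  by under eq_fun do rewrite big_ord0; exact: L1_cst.
by under eq_fun do rewrite big_ord_recr /=; apply: L1D => //; exact: IH.
Qed.

Lemma L1_dominated f g : measurable_fun setT f -> (forall w, `|f w| <= g w) ->
  L1 g -> L1 f.
Proof.
move=> mf fg; apply: le_integrable => //; first exact/measurable_EFinP.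
move=> w _; rewrite /= lee_fin [leRHS]ger0_norm ?fg //.
exact: le_trans (normr_ge0 _) (fg w).
Qed.

Lemma ge0_L1 f : measurable_fun setT f -> (forall w, 0 <= f w) ->
  ('E_P[f] < +oo)%E -> L1 f.
Proof.
move=> mf f0; rewrite unlock => foo; apply/integrableP; split.
  exact/measurable_EFinP.
by under eq_integral do rewrite /= ger0_norm //.
Qed.

Lemma mean_cst (r : R) : mean (fun=> r) = r.
Proof. by apply: mean_expectation; rewrite expectation_cst. Qed.

Lemma meanD f g : L1 f -> L1 g -> mean (fun w => f w + g w) = mean f + mean g.
Proof. exact: RintegralD. Qed.

Lemma meanB f g : L1 f -> L1 g -> mean (fun w => f w - g w) = mean f - mean g.
Proof. exact: RintegralB. Qed.

Lemma meanZ (k : R) f : L1 f -> mean (fun w => k * f w) = k * mean f.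
Proof. by move=> f1; rewrite /mean RintegralZl. Qed.

Lemma mean_sum n (f : 'I_n -> T -> R) : (forall i, L1 (f i)) ->
  mean (fun w => \sum_(i < n) f i w) = \sum_(i < n) mean (f i).
Proof.
elim: n f => [|n IH] f f1.
  by rewrite big_ord0 -[RHS](mean_cst 0); congr mean; apply/funext => w; rewrite big_ord0.
under eq_fun do rewrite big_ord_recr /=.
by rewrite meanD //; [rewrite big_ord_recr IH|exact: L1_sum].
Qed.

Lemma mean_ge0 f : (forall w, 0 <= f w) -> 0 <= mean f.
Proof. by move=> f0; apply: Rintegral_ge0. Qed.

Lemma le_mean f g : L1 f -> L1 g -> (forall w, f w <= g w) -> mean f <= mean g.
Proof. by move=> f1 g1 fg; apply: le_Rintegral => //. Qed.

Lemma L2_measurable f : L2 f -> measurable_fun setT f. Proof. by case. Qed.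

Lemma L2_sqr f : L2 f -> L1 (fun w => f w ^+ 2). Proof. by case. Qed.

Lemma L2M f g : L2 f -> L2 g -> L1 (fun w => f w * g w).
Proof.
move=> [mf f2] [mg g2]; apply: (L1_dominated _ _ (L1D f2 g2)).
  exact: measurable_funM.
move=> w /=; rewrite ler_norml; apply/andP; split; nra.
Qed.

Lemma L2_cst (r : R) : L2 (fun=> r).
Proof. by split; [exact: measurable_cst|exact: L1_cst]. Qed.

Lemma L2D f g : L2 f -> L2 g -> L2 (fun w => f w + g w).
Proof.
move=> f2 g2; split.
  by apply: measurable_funD; exact: L2_measurable.
rewrite [X in L1 X](_ : _ = fun w => (f w ^+ 2 + 2 * (f w * g w)) + g w ^+ 2).
  by apply: L1D; [apply: L1D; [exact: L2_sqr|apply/L1Z/L2M]|exact: L2_sqr].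
by apply/funext => w; ring.
Qed.

Lemma L2Z (k : R) f : L2 f -> L2 (fun w => k * f w).
Proof.
move=> f2; split; first by apply: measurable_funM => //; exact: L2_measurable.
under eq_fun do rewrite exprMn.
by apply: L1Z; exact: L2_sqr.
Qed.

Lemma L2B f g : L2 f -> L2 g -> L2 (fun w => f w - g w).
Proof.
move=> f2 g2; under eq_fun do rewrite -mulN1r.
by apply: L2D => //; exact: L2Z.
Qed.

Lemma L2_L1 f : L2 f -> L1 f.
Proof.
move=> f2; have := L2M (L2_cst 1) f2.
by congr L1; apply/funext => w; rewrite mul1r.
Qed.

Lemma indep_rv_comp {d1 d2 d3 d4} {S1 : measurableType d1}
    {S2 : measurableType d2} {S3 : measurableType d3} {S4 : measurableType d4}
    (U : T -> S1) (V : T -> S2) (h : S1 -> S3) (k : S2 -> S4) :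
  measurable_fun setT h -> measurable_fun setT k ->
  indep_rv P U V -> indep_rv P (h \o U) (k \o V).
Proof.
move=> mh mk UV A B mA mB; apply: (UV (h @^-1` A) (k @^-1` B)).
  by rewrite -[X in measurable X]setTI; exact: mh.
by rewrite -[X in measurable X]setTI; exact: mk.
Qed.

(** Independence replaces the square-integrability needed in [L2M]. *)
Lemma L1_indepM f g : L1 f -> L1 g -> indep_rv P f g ->
  L1 (fun w => f w * g w).
Proof.
move=> f1 g1 fg; have mf := L1_measurable f1; have mg := L1_measurable g1.
have mN : measurable_fun setT (@Num.norm R R) by exact: normr_measurable.
apply/integrableP; split; first by apply/measurable_EFinP; exact: measurable_funM.
have := ge0_expectation_indepM (measurableT_comp mN mf) (measurableT_comp mN mg)
  (indep_rv_comp mN mN fg) (fun _ => normr_ge0 _) (fun _ => normr_ge0 _).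
rewrite unlock => E; under eq_integral do rewrite /= normrM.
rewrite E; apply: lte_mul_pinfty.
- by apply: integral_ge0 => w _; rewrite lee_fin /=.
- exact: (integrable_fin_num measurableT (integrable_norm f1)).
- by have /integrable_norm/integrableP[_] := g1; under eq_integral do rewrite /= normr_id.
Qed.

(** The nonnegative case extends to integrable variables by splitting both
    factors into positive and negative parts. *)
Lemma mean_indepM f g : L1 f -> L1 g -> indep_rv P f g ->
  mean (fun w => f w * g w) = mean f * mean g.
Proof.
move=> f1 g1 fg; have mf := L1_measurable f1; have mg := L1_measurable g1.
pose p (x : R) : R := Num.max x 0; pose n (x : R) : R := Num.max (- x) 0.
have mp : measurable_fun setT p by apply: measurable_maxr => //.
have mn : measurable_fun setT n by apply: measurable_maxr => //; exact: oppr_measurable.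
have p0 x : 0 <= p x by rewrite le_max lexx orbT.
have n0 x : 0 <= n x by rewrite le_max lexx orbT.
have pn x : x = p x - n x.
  by rewrite /p /n; case: (lerP x 0) => x0;
    case: (lerP (- x) 0) => nx0; lra.
have ple x : `|p x| <= `|x|.
  by rewrite (ger0_norm (p0 x)) /p ge_max ler_norm normr_ge0.
have nle x : `|n x| <= `|x|.
  by rewrite (ger0_norm (n0 x)) /n ge_max -normrN ler_norm normr_ge0.
have L1abs h k : L1 h -> measurable_fun setT (k : R -> R) ->
    (forall x, `|k x| <= `|x|) -> L1 (k \o h).
  move=> h1 mk kle; apply: (L1_dominated _ (fun w => kle (h w))).
    by apply: measurableT_comp => //; exact: L1_measurable.
  exact: integrable_norm.
have pM (h k : R -> R) : measurable_fun setT h -> measurable_fun setT k ->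
    (forall x, 0 <= h x) -> (forall x, 0 <= k x) ->
    (forall x, `|h x| <= `|x|) -> (forall x, `|k x| <= `|x|) ->
    L1 (fun w => h (f w) * k (g w)) /\
    mean (fun w => h (f w) * k (g w)) = mean (h \o f) * mean (k \o g).
  move=> mh mk h0 k0 hle kle.
  have hf1 : L1 (h \o f) by exact: L1abs.
  have kg1 : L1 (k \o g) by exact: L1abs.
  have I := indep_rv_comp mh mk fg.
  split; first exact: (L1_indepM hf1 kg1 I).
  apply: mean_expectation; rewrite EFinM -!expectation_mean //.
  rewrite -ge0_expectation_indepM //.
  - exact: L1_measurable hf1.
  - exact: L1_measurable kg1.
  - by move=> w; exact: h0.
  - by move=> w; exact: k0.
have [pp1 ppE] := pM _ _ mp mp p0 p0 ple ple.
have [pn1 pnE] := pM _ _ mp mn p0 n0 ple nle.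
have [np1 npE] := pM _ _ mn mp n0 p0 nle ple.
have [nn1 nnE] := pM _ _ mn mn n0 n0 nle nle.
transitivity (mean (fun w => (p (f w) * p (g w) - p (f w) * n (g w)) -
    (n (f w) * p (g w) - n (f w) * n (g w)))).
  by congr mean; apply/funext => w; rewrite [f w in LHS]pn [g w in LHS]pn; ring.
rewrite meanB; [|exact: L1B..].
rewrite !meanB // ppE pnE npE nnE.
have -> : mean f = mean (p \o f) - mean (n \o f).
  by rewrite -meanB; [congr mean; apply/funext => w; exact: pn|exact: L1abs..].
have -> : mean g = mean (p \o g) - mean (n \o g).
  by rewrite -meanB; [congr mean; apply/funext => w; exact: pn|exact: L1abs..].
ring.
Qed.

End integrability.

(** * Filtrations and independent increments *)

Section adapted.
Context {R : realType} {d : measure_display} {T : measurableType d}.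
Variable P : probability T R.
Implicit Types (F G : set (set T)).

Definition adapted {d'} {S : measurableType d'} F (U : T -> S) :=
  forall B, measurable B -> F (U @^-1` B).

Lemma adaptedE {d'} {S : measurableType d'} G (U : T -> S) :
  adapted <<s G>> U =
  measurable_fun [set: g_sigma_algebraType G] (U : g_sigma_algebraType G -> S).
Proof.
apply/propext; split=> [aU _ B mB|mU B mB]; first by rewrite setTI; exact: aU.
by have := mU measurableT B mB; rewrite setTI.
Qed.

Lemma adapted_sub {d'} {S : measurableType d'} F G (U : T -> S) :
  F `<=` G -> adapted F U -> adapted G U.
Proof. by move=> FG aU B mB; apply/FG/aU. Qed.

Lemma adapted_measurable {d'} {S : measurableType d'} F (U : T -> S) :
  F `<=` measurable -> adapted F U -> measurable_fun setT U.
Proof. by move=> Fm aU _ B mB; rewrite setTI; apply/Fm/aU. Qed.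

Definition indep_of F (V : T -> R) := forall A B, F A -> measurable B ->
  P (A `&` V @^-1` B) = (P A * P (V @^-1` B))%E.

Lemma indep_of_rv {d'} {S : measurableType d'} F (U : T -> S) V :
  indep_of F V -> adapted F U -> indep_rv P U V.
Proof. by move=> FV aU A B mA mB; apply: FV => //; exact: aU. Qed.

Lemma sigma_algebraI G A B : <<s G>> A -> <<s G>> B -> <<s G>> (A `&` B).
Proof. exact: (@measurableI _ (g_sigma_algebraType G)). Qed.

(** If V is independent of F and the pair (F, V) lives in a sigma-algebra
    independent of H, then adding H to F keeps independence: this holds on the
    intersections A `&` B with A in F and B in H, which generate the join. *)
Lemma indep_of_join F H K V :
  F `<=` measurable -> H `<=` measurable ->
  setI_closed F -> setI_closed H -> F setT -> H setT -> setI_closed K ->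
  F `<=` K -> adapted K V -> indep P K H -> indep_of F V ->
  measurable_fun setT V ->
  indep_of <<s F `|` H>> V.
Proof.
move=> Fm Hm FI HI FT HT KI FK KV KH FV mV A B FHA mB.
have mC : measurable (V @^-1` B) by rewrite -[X in measurable X]setTI; exact: mV.
pose G := [set A `&` B | A in F & B in H].
have FHG : <<s F `|` H>> `<=` <<s G>>.
  apply: smallest_sub; first exact: smallest_sigma_algebra.
  move=> E [FE|HE]; apply: sub_sigma_algebra.
    by exists E => //; exists setT => //; rewrite setIT.
  by exists setT => //; exists E => //; rewrite setTI.
have /fineK PC : P (V @^-1` B) \is a fin_num by exact: fin_num_measure.
have PC0 : 0 <= fine (P (V @^-1` B)) by exact: fine_ge0.
rewrite muleC -PC.
apply: (@g_sigma_algebra_measure_unique _ _ _ G _ (fun=> setT) _ _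
  (mrestr P mC) (mscale (NngNum PC0) P)).
- by move=> _ [E FE [E' HE' <-]]; apply: measurableI; [exact: Fm|exact: Hm].
- by move=> _; exists setT => //; exists setT => //; rewrite setIT.
- by rewrite bigcup_const //; exists 0%N.
- move=> _ _ [E FE [E' HE' <-]] [E1 FE1 [E1' HE1' <-]].
  by exists (E `&` E1); [exact: FI|exists (E' `&` E1'); [exact: HI|rewrite setIACA]].
- move=> _ [E FE [E' HE' <-]]; 
  change (P (E `&` E' `&` V @^-1` B) =
    (fine (P (V @^-1` B)))%:E * P (E `&` E'))%E; rewrite PC.
  rewrite setIAC KH //; last by apply: KI; [exact: FK|exact: KV].
  by rewrite FV // KH //; [rewrite muleCA muleA|exact: FK].
- by move=> k; apply: fin_num_fun_lty; exact: fin_num_measure.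
- exact: FHG.
Qed.

End adapted.

(** * The past of one component joined with the other component *)

Section brownian.
Context {R : realType} {d : measure_display} {T : measurableType d}.
Variables (P : probability T R) (D : set R).
Implicit Types X Y : R -> {RV P >-> R}.

Lemma sigma_gen_measurable (E : set R) X : sigma_gen E X `<=` measurable.
Proof.
apply: smallest_sub; first exact: sigma_algebra_measurable.
move=> A [i _ [B mB <-]]; exact: measurable_funPT.
Qed.

Lemma sigma_gen_adapted (E : set R) X t : E t -> adapted (sigma_gen E X) (X t).
Proof.
move=> Et B mB; apply: sub_sigma_algebra; exists t => //.
by exists B => //; rewrite setTI.
Qed.

Lemma sigma_genS (E E' : set R) X : E `<=` E' -> sigma_gen E X `<=` sigma_gen E' X.
Proof.
move=> EE'; apply: sub_sigma_algebra2 => A [i Ei XA].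
by exists i => //; exact: EE'.
Qed.

(** The past of [X] up to [s] together with the whole path of [Y].  It contains
    the planar filtration at [s] and is still independent of later increments of
    [X]; both the increments of the two components over one step and integrals of
    one component against the other can be treated with it. *)
Definition joint_past X Y s :=
  <<s sigma_gen (D `&` `]-oo, s]) X `|` sigma_gen D Y>>.

Lemma joint_past_measurable X Y s : joint_past X Y s `<=` measurable.
Proof.
apply: smallest_sub; first exact: sigma_algebra_measurable.
by move=> A [|]; exact: sigma_gen_measurable.
Qed.

Lemma adapted_bm X Y s t : D s -> s <= t -> adapted (joint_past X Y t) (X s).
Proof.
move=> Ds st; apply: (adapted_sub (F := sigma_gen (D `&` `]-oo, t]) X)).
  by move=> A FA; apply: sub_sigma_algebra; left.
by apply: sigma_gen_adapted; split => //=; rewrite ?in_itv /=.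
Qed.

Lemma adapted_bm_snd X Y s t : D s -> adapted (joint_past X Y t) (Y s).
Proof.
move=> Ds; apply: (adapted_sub (F := sigma_gen D Y)).
  by move=> A FA; apply: sub_sigma_algebra; right.
exact: sigma_gen_adapted.
Qed.

Lemma adaptedB E X s t : E s -> E t ->
  adapted (sigma_gen E X) (fun w => X t w - X s w).
Proof.
move=> Es Et; rewrite adaptedE; apply: measurable_funB.
  by rewrite -adaptedE; exact: sigma_gen_adapted.
by rewrite -adaptedE; exact: sigma_gen_adapted.
Qed.

Lemma indep_joint_past X Y s t : brownian_motion D X ->
  indep P (sigma_gen D X) (sigma_gen D Y) -> D s -> D t -> s < t ->
  indep_of P (joint_past X Y s) (fun w => X t w - X s w).
Proof.
move=> bX XY Ds Dt st; apply: (indep_of_join (K := sigma_gen D X)) => //.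
- exact: sigma_gen_measurable.
- exact: sigma_gen_measurable.
- exact: sigma_algebraI.
- exact: sigma_algebraI.
- exact: (@measurableT _ (g_sigma_algebraType _)).
- exact: (@measurableT _ (g_sigma_algebraType _)).
- exact: sigma_algebraI.
- by apply: sigma_genS => u [].
- exact: adaptedB.
- move=> A B FA mB; rewrite setIC muleC.
  apply: (bm_indep_incr bX Ds Dt st) => //.
  apply: sub_sigma_algebra; exists tt => //; exists B => //; by rewrite setTI.
- exact: measurable_funB.
Qed.

Lemma planar_filtration_sub X Y s : D s ->
  planar_filtration D X Y s `<=` joint_past X Y s.
Proof.
move=> Ds; apply: smallest_sub; first exact: smallest_sigma_algebra.
move=> A [XA|YA]; apply: sub_sigma_algebra; [by left|right].
by apply: sigma_genS YA => u [].
Qed.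

Lemma planar_filtrationC X Y s : planar_filtration D X Y s = planar_filtration D Y X s.
Proof. by rewrite /planar_filtration setUC. Qed.

Lemma planar_brownian_motionC X Y :
  planar_brownian_motion D X Y -> planar_brownian_motion D Y X.
Proof.
case=> bX bY XY; split=> // A B YA XB; rewrite setIC muleC; exact: XY.
Qed.

End brownian.

(** * Moment generating function of the discrete area *)

Section gaussian_step.
Context {R : realType} {d : measure_display} {T : measurableType d}.
Variable P : probability T R.

Definition centred_normal (v : R) (V : T -> R) := forall B, measurable B ->
  P (V @^-1` B) = normal_prob 0 (Num.sqrt v) B.

Lemma ge0_integral_centred_normal v V (g : R -> R) :
  measurable_fun setT V -> centred_normal v V ->
  measurable_fun setT g -> (forall x, 0 <= g x) ->
  (\int[P]_w (g (V w))%:E = \int[normal_prob 0 (Num.sqrt v)]_x (g x)%:E)%E.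
Proof.
move=> mV nV mg g0.
pose V' : {mfun T >-> R} := mfun_Sub (mem_set mV).
transitivity (\int[distribution P V']_x (g x)%:E)%E.
  by rewrite ge0_integral_distribution //; exact/measurable_EFinP.
pose idn : measurableTypeR R -> R := @id R.
have mid : measurable_fun setT idn by move=> _ B mB; rewrite setTI.
pose id' : {mfun (measurableTypeR R) >-> R} := mfun_Sub (mem_set mid).
pose nu := distribution (normal_prob 0 (Num.sqrt v)) id'.
rewrite (eq_measure_integral nu); last by move=> A mA _; exact: nV.
by rewrite ge0_integral_distribution //; exact/measurable_EFinP.
Qed.

(** Conditionally on [F] this is [integral_normal_exp_quadratic], with [al] and
    [K] frozen. *)
Lemma expectation_exp_quadratic (F : set (set T)) (K al V : T -> R) (v be : R) :
  F `<=` measurable -> adapted F (fun w => (K w, al w)) -> (forall w, 0 <= K w) ->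
  measurable_fun setT V -> indep_of P F V -> centred_normal v V ->
  0 < v -> be * v < 1 ->
  ('E_P[(fun w => K w * expR (al w * V w + be / 2 * V w ^+ 2))%R] =
   ((Num.sqrt (1 - be * v))^-1)%:E *
   'E_P[(fun w => K w * expR (al w ^+ 2 * v / (2 * (1 - be * v))))%R])%E.
Proof.
move=> Fm aKal K0 mV iV nV v0 bev; rewrite !unlock.
have mKal := adapted_measurable Fm aKal.
have mK : measurable_fun setT K by exact: (measurableT_comp measurable_fst mKal).
have mal : measurable_fun setT al by exact: (measurableT_comp measurable_snd mKal).
have mq : measurable_fun setT (fun x : R => be / 2 * x ^+ 2).
  by apply: measurable_funM => //.
pose g (z : (R * R) * R) : \bar R :=
  (`|z.1.1| * expR (z.1.2 * z.2 + be / 2 * z.2 ^+ 2))%:E.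
have mg : measurable_fun setT g.
  apply/measurable_EFinP; apply: measurable_funM.
    by apply: measurableT_comp => //; apply: measurableT_comp.
  apply: measurableT_comp => //; apply: measurable_funD.
    by apply: measurable_funM => //; apply: measurableT_comp.
  by apply: (measurableT_comp mq).
transitivity (\int[P]_w g ((K w, al w), V w))%E.
  by apply: eq_integral => w _; rewrite /g /= ger0_norm.
rewrite (ge0_integral_indep mKal mV (indep_of_rv iV aKal) mg); last first.
  by move=> z; rewrite lee_fin mulr_ge0 ?expR_ge0.
have me : measurable_fun setT (fun w => expR (al w ^+ 2 * v / (2 * (1 - be * v)))).
  apply: measurableT_comp => //; apply: measurable_funM => //.
  by apply: measurable_funM => //; exact: measurable_funX.
rewrite -ge0_integralZl //; last 2 first.
- by apply/measurable_EFinP; exact: measurable_funM.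
- by move=> w _; rewrite lee_fin mulr_ge0 ?expR_ge0.
apply: eq_integral => w _.
transitivity ((K w)%:E * \int[P]_w' (expR (al w * V w' + be / 2 * V w' ^+ 2))%:E)%E.
  rewrite -ge0_integralZl ?lee_fin //.
  - by apply: eq_integral => w' _; rewrite /g /= ger0_norm.
  - apply/measurable_EFinP; apply: measurableT_comp => //.
    apply: measurable_funD; first exact: measurable_funM.
    exact: (measurableT_comp mq).
pose h (x : R) := expR (al w * x + be / 2 * x ^+ 2).
rewrite (ge0_integral_centred_normal (g := h) mV nV); last 2 first.
- apply: measurableT_comp => //; apply: measurable_funD; last exact: mq.
  exact: measurable_funM.
- by move=> x; exact: expR_ge0.
by rewrite integral_normal_exp_quadratic // -!EFinM mulrCA.
Qed.

End gaussian_step.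

Section path_area.
Context {R : realType}.
Implicit Types x y : nat -> R.

(** The left-endpoint Riemann sum of the integral of x - x(0) against dy for a
    sampled path, and below it the area swept by the polygonal path. *)
Definition path_sum x y k : R := \sum_(i < k) (x i - x 0%N) * (y i.+1 - y i).

Definition path_area x y k : R := 2^-1 * (path_sum x y k - path_sum y x k).

Definition path_sqr_dist x y k : R := (x k - x 0%N) ^+ 2 + (y k - y 0%N) ^+ 2.

Lemma path_areaS x y k : path_area x y k.+1 = path_area x y k +
  2^-1 * ((x k - x 0%N) * (y k.+1 - y k) - (y k - y 0%N) * (x k.+1 - x k)).
Proof. by rewrite /path_area /path_sum !big_ord_recr /=; ring. Qed.

Lemma measurable_path_sum {d} {T : measurableType d} (x y : nat -> T -> R) k :
  (forall i, (i <= k)%N -> measurable_fun setT (x i)) ->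
  (forall i, (i <= k)%N -> measurable_fun setT (y i)) ->
  measurable_fun setT (fun w => path_sum (x^~ w) (y^~ w) k).
Proof.
move=> mx my; apply: measurable_sum => i.
by apply: measurable_funM; apply: measurable_funB;
  (apply: mx || apply: my) => //; exact: ltnW.
Qed.

Lemma measurable_path_area {d} {T : measurableType d} (x y : nat -> T -> R) k :
  (forall i, (i <= k)%N -> measurable_fun setT (x i)) ->
  (forall i, (i <= k)%N -> measurable_fun setT (y i)) ->
  measurable_fun setT (fun w => path_area (x^~ w) (y^~ w) k).
Proof.
move=> mx my; apply: measurable_funM => //.
by apply: measurable_funB; exact: measurable_path_sum.
Qed.

End path_area.

Section discrete_area.
Context {R : realType} {d : measure_display} {T : measurableType d}.
Variables (P : probability T R) (D : set R) (X Y : R -> {RV P >-> R}).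
Hypothesis pXY : planar_brownian_motion D X Y.
Variables (t : nat -> R) (N : nat) (dt : R).
Hypothesis dt0 : 0 < dt.
Hypothesis Dt : forall k, (k <= N)%N -> D (t k).
Hypothesis tS : forall k, t k.+1 = t k + dt.

Lemma t_le i k : (i <= k)%N -> t i <= t k.
Proof.
elim: k => [|k IH]; first by rewrite leqn0 => /eqP ->.
rewrite leq_eqVlt => /predU1P[->//|/IH h].
by rewrite tS (le_trans h) // lerDl ltW.
Qed.

Lemma bm_incr_normal (W : R -> {RV P >-> R}) k : brownian_motion D W -> (k < N)%N ->
  centred_normal P dt (fun w => W (t k.+1) w - W (t k) w).
Proof.
move=> bW kN B mB; have := @bm_normal_incr _ _ _ _ _ _ bW (t k) (t k.+1).
rewrite tS addrAC subrr add0r -tS; apply => //; [exact/Dt/ltnW|exact: Dt|].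
by rewrite tS ltrDl.
Qed.

Let x w i := X (t i) w.
Let y w i := Y (t i) w.
Let area k w := path_area (x w) (y w) k.
Let rho k w := path_sqr_dist (x w) (y w) k.

(** One step of the walk, conditionally on the past: integrating out the
    increment of Y and then that of X is completing the square twice, and the
    two prefactors [(1 - 2 c dt)^(-1/2)] multiply up. *)
Lemma expectation_area_step (z c : R) k : (k < N)%N -> 2 * c * dt < 1 ->
  ('E_P[(fun w => expR (z * area k.+1 w + c * rho k.+1 w))%R] =
   ((1 - 2 * c * dt)^-1)%:E *
   'E_P[(fun w => expR (z * area k w +
      (c + (z ^+ 2 / 4 + 4 * c ^+ 2) * dt / (2 * (1 - 2 * c * dt))) * rho k w))%R])%E.
Proof.
move=> kN cdt; have [bX bY iXY] := pXY.
have [_ _ iYX] := planar_brownian_motionC pXY.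
have dk : t k < t k.+1 by rewrite tS ltrDl.
have Dk : D (t k) by apply: Dt; exact: ltnW.
have Dk1 : D (t k.+1) by exact: Dt.
set k0 := 1 - 2 * c * dt; have k0_gt0 : 0 < k0 by rewrite subr_gt0.
pose xi w := X (t k.+1) w - X (t k) w; pose eta w := Y (t k.+1) w - Y (t k) w.
pose x' w := X (t k) w - X (t 0%N) w; pose y' w := Y (t k) w - Y (t 0%N) w.
pose al w := z / 2 * x' w + 2 * c * y' w.
pose al' w := 2 * c * x' w - z / 2 * y' w.
pose K w := expR (z * area k w - z / 2 * y' w * xi w + c * (x' w + xi w) ^+ 2
  + c * y' w ^+ 2).
pose K' w := expR (z * area k w + c * x' w ^+ 2 + c * y' w ^+ 2 +
  al w ^+ 2 * dt / (2 * k0)).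
have E1 : (fun w => expR (z * area k.+1 w + c * rho k.+1 w)) =
    fun w => K w * expR (al w * eta w + (2 * c) / 2 * eta w ^+ 2).
  apply/funext => w; rewrite -expRD; congr expR.
  rewrite /area path_areaS /rho /path_sqr_dist /K /al /x' /y' /xi /eta /x /y.
  by field.
have E2 : (fun w => K w * expR (al w ^+ 2 * dt / (2 * k0))) =
    fun w => K' w * expR (al' w * xi w + (2 * c) / 2 * xi w ^+ 2).
  apply/funext => w; rewrite -!expRD; congr expR; rewrite /al'.
  by field; rewrite gt_eqF.
have E3 : (fun w => K' w * expR (al' w ^+ 2 * dt / (2 * k0))) =
    fun w => expR (z * area k w +
      (c + (z ^+ 2 / 4 + 4 * c ^+ 2) * dt / (2 * k0)) * rho k w).
  apply/funext => w; rewrite -!expRD; congr expR.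
  rewrite /al' /al /rho /path_sqr_dist -/(x' w) -/(y' w) /x' /y' /x /y.
  by field; rewrite gt_eqF.
have mX i : measurable_fun setT (X (t i)) by [].
have mY i : measurable_fun setT (Y (t i)) by [].
have mKal d1 (S : measurableType d1) (f g h e : S -> R) :
    measurable_fun setT f -> measurable_fun setT g -> measurable_fun setT h ->
    measurable_fun setT e ->
    measurable_fun setT (fun w => (expR (z * f w - z / 2 * h w * e w +
      c * (g w + e w) ^+ 2 + c * h w ^+ 2), z / 2 * g w + 2 * c * h w)).
  move=> mf mg mh me; apply: measurable_fun_pair.
    apply: measurableT_comp => //.
    repeat first [exact: measurable_cst | assumption | apply: measurable_funB |
      apply: measurable_funD | apply: measurable_funM | apply: measurable_funX].
  by apply: measurable_funD; apply: measurable_funM.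
have mKal' d1 (S : measurableType d1) (f g h : S -> R) :
    measurable_fun setT f -> measurable_fun setT g -> measurable_fun setT h ->
    measurable_fun setT (fun w => (expR (z * f w + c * g w ^+ 2 + c * h w ^+ 2 +
      (z / 2 * g w + 2 * c * h w) ^+ 2 * dt / (2 * k0)),
      2 * c * g w - z / 2 * h w)).
  move=> mf mg mh; apply: measurable_fun_pair.
    apply: measurableT_comp => //.
    repeat first [exact: measurable_cst | assumption | apply: measurable_funB |
      apply: measurable_funD | apply: measurable_funM | apply: measurable_funX].
  by apply: measurable_funB; apply: measurable_funM.
rewrite E1 (@expectation_exp_quadratic _ _ _ _ (joint_past D Y X (t k)) _ _ eta dt) //.
- rewrite E2 (@expectation_exp_quadratic _ _ _ _ (joint_past D X Y (t k)) _ _ xi dt) //.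
  + rewrite E3 muleA -EFinM; congr (_%:E * _)%E.
    by rewrite -invfM -expr2 sqr_sqrtr ?ltW.
  + exact: joint_past_measurable.
  + rewrite adaptedE.
    have aX i : (i <= k)%N -> measurable_fun
        [set: g_sigma_algebraType (sigma_gen (D `&` `]-oo, t k]) X `|` sigma_gen D Y)]
        (X (t i)).
      move=> ik; rewrite -adaptedE; apply: adapted_bm; last exact: t_le.
      by apply: Dt; exact: leq_trans ik (ltnW kN).
    have aY i : (i <= k)%N -> measurable_fun
        [set: g_sigma_algebraType (sigma_gen (D `&` `]-oo, t k]) X `|` sigma_gen D Y)]
        (Y (t i)).
      move=> ik; rewrite -adaptedE; apply: adapted_bm_snd.
      by apply: Dt; exact: leq_trans ik (ltnW kN).
    apply: mKal'.
    - by apply: measurable_path_area => i ik; [exact: aX|exact: aY].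
    - by apply: measurable_funB; exact: aX.
    - by apply: measurable_funB; exact: aY.
  + by move=> w; exact: expR_ge0.
  + exact: measurable_funB.
  + exact: indep_joint_past.
  + exact: bm_incr_normal.
- exact: joint_past_measurable.
- rewrite adaptedE.
  have aY i : (i <= k)%N -> measurable_fun
      [set: g_sigma_algebraType (sigma_gen (D `&` `]-oo, t k]) Y `|` sigma_gen D X)]
      (Y (t i)).
    move=> ik; rewrite -adaptedE; apply: adapted_bm; last exact: t_le.
    by apply: Dt; exact: leq_trans ik (ltnW kN).
  have aX i : (i <= k.+1)%N -> measurable_fun
      [set: g_sigma_algebraType (sigma_gen (D `&` `]-oo, t k]) Y `|` sigma_gen D X)]
      (X (t i)).
    move=> ik; rewrite -adaptedE; apply: adapted_bm_snd.
    by apply: Dt; exact: leq_trans ik kN.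
  apply: mKal.
  + by apply: measurable_path_area => i ik; [apply: aX; exact: leqW|exact: aY].
  + by apply: measurable_funB; exact: aX.
  + by apply: measurable_funB; exact: aY.
  + by apply: measurable_funB; exact: aX.
- by move=> w; exact: expR_ge0.
- exact: measurable_funB.
- exact: indep_joint_past.
- exact: bm_incr_normal.
Qed.

(** Iterating [expectation_area_step] from [c = z / 4 * (s j / q j)] shifts [j] by
    one at each step: the update of [c] is the recursion of [s] and [q], and the
    prefactor is [q j / q j.+1].  Positivity of [q] is what keeps the quadratic
    exponents integrable. *)
Lemma expectation_exp_area (z : R) (q s : nat -> R) k j :
  let w := z * dt / 2 in
  (forall i, q i.+1 = q i - w * s i) -> (forall i, s i.+1 = s i + w * q i) ->
  (forall i, (i <= j + k)%N -> 0 < q i) -> (k <= N)%N ->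
  ('E_P[(fun w => expR (z * area k w + z / 4 * (s j / q j) * rho k w))%R] =
   (q j / q (j + k)%N)%:E)%E.
Proof.
move=> w qS sS; elim: k j => [|k IH] j q0 kN.
  rewrite addn0 divff ?gt_eqF ?q0 ?leq_addr //.
  rewrite -[RHS](expectation_cst P 1); congr ('E_P[_])%E; apply/funext => o /=.
  rewrite /area /rho /path_area /path_sqr_dist /path_sum !big_ord0 !subrr.
  by rewrite expr0n /= !(mulr0, addr0) expR0.
have qj : 0 < q j by apply: q0; exact: leq_addr.
have qj1 : 0 < q j.+1 by apply: q0; rewrite addnS ltnS leq_addr.
have E : 1 - 2 * (z / 4 * (s j / q j)) * dt = q j.+1 / q j.
  by rewrite qS /w; field; rewrite gt_eqF.
rewrite expectation_area_step //; last first.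
  by rewrite -subr_gt0 E divr_gt0.
rewrite E addnS -addSn.
rewrite [X in (_ * 'E_P[X])%E](_ : _ = (fun o => expR (z * area k o +
    z / 4 * (s j.+1 / q j.+1) * rho k o))%R); last first.
  apply/funext => o; congr expR; congr (_ + _ * _).
  rewrite sS; have := gt_eqF qj1; rewrite qS /w => /negbT qj1n.
  field; rewrite (gt_eqF qj) andbT; apply: contra_neq qj1n => e; lra.
rewrite IH; last 2 first.
- by move=> i ij; apply: q0; rewrite addnS -addSn.
- exact: ltnW.
by rewrite -EFinM; congr EFin; field; rewrite !gt_eqF // q0 // addnS -addSn.
Qed.

End discrete_area.

(** * From moment generating functions to moments *)

Section taylor.
Context {R : realType}.

Lemma series_exp_le (x : R) m : 0 <= x -> \sum_(0 <= k < m) x ^+ k / k`!%:R <= expR x.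
Proof.
move=> x0.
have nd : nondecreasing_seq (series (exp_coeff x)).
  apply/nondecreasing_seqP => n; rewrite /series /= big_nat_recr //= lerDl.
  by rewrite /exp_coeff /= divr_ge0 ?exprn_ge0.
have := nondecreasing_cvgn_le nd (is_cvg_series_exp_coeff x) m.
by rewrite /series /=.
Qed.

(** Shifting the index by n bounds the tail of the exponential series termwise by
    |u|^n times the series at |u|, because k! <= (n + k)! . *)
Lemma expR_taylor (u : R) n :
  `|expR u - \sum_(0 <= k < n) u ^+ k / k`!%:R| <= `|u| ^+ n * expR `|u|.
Proof.
set c := \sum_(_ <= _ < _) _.
have cv : `|series (exp_coeff u) m - c| @[m --> \oo] --> `|expR u - c|.
  apply: cvg_norm; apply: cvgB; last exact: cvg_cst.
  exact: is_cvg_series_exp_coeff.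
rewrite -(cvg_lim _ cv) //; apply: limr_le.
  by apply/cvg_ex; eexists; exact: cv.
near=> m.
have nm : (n <= m)%N by near: m; exists n.
rewrite /series /= (big_cat_nat (n := n)) //= /exp_coeff /= addrAC subrr add0r.
apply: le_trans (ler_norm_sum _ _ _) _.
apply: (@le_trans _ _ (\sum_(0 <= k < m - n) `|u| ^+ n * (`|u| ^+ k / k`!%:R))).
  rewrite -{1}[n]add0n big_addn; apply: ler_sum => k _.
  rewrite normrM normrX normfV (ger0_norm (ler0n _ _)) addnC exprD -mulrA.
  rewrite ler_wpM2l ?exprn_ge0 // ler_wpM2l ?exprn_ge0 //.
  by rewrite lef_pV2 ?posrE ?ltr0n ?fact_gt0 // ler_nat leq_fact // leq_addl.
by rewrite -mulr_sumr ler_wpM2l ?exprn_ge0 // series_exp_le.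
Unshelve. all: by end_near. Qed.

Lemma exprn_le_exp (x : R) n : 0 <= x -> x ^+ n <= n`!%:R * expR x.
Proof.
move=> x0; have f0 : 0 < n`!%:R :> R by rewrite ltr0n fact_gt0.
rewrite -ler_pdivrMl // mulrC; case: n {f0} => [|n].
  by rewrite expr0 fact0 divr1 -[leLHS]expR0 ler_expR.
by apply: le_trans (expR_ge1Dxn n x0); rewrite lerDr.
Qed.

Lemma horner_bounded (p : {poly R}) (e : R) :
  exists B, 0 <= B /\ forall z, 0 < z <= e -> `|p.[z]| <= B.
Proof.
exists (\sum_(i < size p) `|p`_i| * `|e| ^+ i); split.
  by apply: sumr_ge0 => i _; rewrite mulr_ge0 ?exprn_ge0.
move=> z /andP[z0 ze]; rewrite horner_coef; apply: le_trans (ler_norm_sum _ _ _) _.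
have zle : `|z| <= `|e| by rewrite (ger0_norm (ltW z0)) (le_trans ze) // ler_norm.
apply: ler_sum => i _; rewrite normrM normrX ler_wpM2l //.
by apply: lerXn2r; rewrite ?nnegrE.
Qed.

(** Dividing by z reduces to the constant coefficient, which is bounded by a
    multiple of every small z; testing positive z is enough. *)
Lemma coef_poly_bigO (p : {poly R}) (e C : R) n : 0 < e ->
  (forall z, 0 < z <= e -> `|p.[z]| <= C * z ^+ n) ->
  forall k, (k < n)%N -> p`_k = 0.
Proof.
move=> e0; elim: n p => // n IH p pC.
pose q := drop_poly 1 p.
have pE z : p.[z] = p`_0 + z * q.[z].
  rewrite -[in LHS](poly_take_drop 1 p) hornerD hornerM hornerXn expr1 mulrC.
  congr (_ + _); rewrite (horner_coef_wide _ (size_take_poly 1 p)) big_ord1.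
  by rewrite coef_take_poly /= expr0 mulr1.
have p00 : p`_0 = 0.
  have [B [B0 qB]] := horner_bounded q e.
  apply/eqP; rewrite -normr_le0; apply/ler_addgt0Pr => r r0; rewrite add0r.
  pose M := `|C| * e ^+ n + B + 1.
  have M0 : 0 < M by rewrite ltr_wpDl // addr_ge0 // mulr_ge0 // exprn_ge0 // ltW.
  pose z := Num.min e (r / M).
  have z0 : 0 < z by rewrite lt_min e0 divr_gt0.
  have ze : z <= e by rewrite ge_min lexx.
  have zr : z * M <= r by rewrite -ler_pdivlMr // ge_min lexx orbT.
  apply: le_trans zr.
  have -> : p`_0 = p.[z] - z * q.[z] by rewrite pE addrK.
  apply: le_trans (ler_normB _ _) _.
  rewrite /M !mulrDr mulr1 -addrA; apply: lerD.
    apply: le_trans (pC z _) _; first by rewrite z0.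
    rewrite exprS mulrCA ler_wpM2l ?(ltW z0) //.
    apply: (@le_trans _ _ (`|C| * z ^+ n)).
      by rewrite ler_wpM2r ?exprn_ge0 ?(ltW z0) // ler_norm.
    by rewrite ler_wpM2l //; apply: lerXn2r; rewrite ?nnegrE ?(ltW z0) ?(ltW e0).
  rewrite normrM (ger0_norm (ltW z0)) -[leLHS]addr0; apply: lerD; last exact: ltW.
  by rewrite ler_wpM2l ?(ltW z0) // qB // z0.
case=> [//|k]; rewrite ltnS => kn.
rewrite -addn1 -coef_drop_poly; apply: (IH _ _ _ kn) => z /andP[z0 ze].
rewrite -(@ler_pM2l _ z) // mulrCA -exprS -[X in X * _](ger0_norm (ltW z0)) -normrM.
by apply: le_trans (pC z _); rewrite ?z0 // pE p00 add0r.
Qed.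

End taylor.

Section moments.
Context {R : realType} {d : measure_display} {T : measurableType d}.
Variable P : probability T R.
Variables (f : T -> R) (z0 : R).
Hypothesis mf : measurable_fun setT f.
Hypothesis z0_gt0 : 0 < z0.

Lemma L1_exp_abs : L1 P (fun w => expR (z0 * f w)) ->
  L1 P (fun w => expR (- (z0 * f w))) -> L1 P (fun w => expR (z0 * `|f w|)).
Proof.
move=> e1 e2; apply: (L1_dominated _ _ (L1D e1 e2)).
  apply: measurableT_comp => //; apply: measurable_funM => //.
  exact: measurableT_comp.
move=> w; rewrite (ger0_norm (expR_ge0 _)).
case: (ger0P (f w)) => fw; first by rewrite lerDl expR_ge0.
by rewrite mulrN lerDr expR_ge0.
Qed.

Lemma exp_abs_le C : ('E_P[(fun w => expR (z0 * f w))%R] <= C%:E)%E ->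
  ('E_P[(fun w => expR (- (z0 * f w)))%R] <= C%:E)%E ->
  L1 P (fun w => expR (z0 * `|f w|)) /\
  mean P (fun w => expR (z0 * `|f w|)) <= C + C.
Proof.
move=> p n; have mz : measurable_fun setT (fun w => z0 * f w).
  exact: measurable_funM.
have p1 : L1 P (fun w => expR (z0 * f w)).
  apply: ge0_L1; [exact: measurableT_comp|by move=> w; exact: expR_ge0|].
  by apply: le_lt_trans p _; rewrite ltry.
have n1 : L1 P (fun w => expR (- (z0 * f w))).
  apply: ge0_L1; last by apply: le_lt_trans n _; rewrite ltry.
    by apply: measurableT_comp => //; exact: measurableT_comp mz.
  by move=> w; exact: expR_ge0.
have l1 := L1_exp_abs p1 n1; split=> //.
apply: (@le_trans _ _ (mean P (fun w => expR (z0 * f w) + expR (- (z0 * f w))))).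
  apply: le_mean => //; first exact: L1D.
  move=> w; case: (ger0P (f w)) => fw; first by rewrite lerDl expR_ge0.
  by rewrite mulrN lerDr expR_ge0.
by rewrite meanD //; apply: lerD; rewrite -lee_fin -expectation_mean.
Qed.

Hypothesis e1 : L1 P (fun w => expR (z0 * `|f w|)).

Lemma L1_exp z : `|z| <= z0 -> L1 P (fun w => expR (z * f w)).
Proof.
move=> zz0; apply: (L1_dominated _ _ e1).
  by apply: measurableT_comp => //; exact: measurable_funM.
move=> w; rewrite (ger0_norm (expR_ge0 _)) ler_expR (le_trans (ler_norm _)) //.
by rewrite normrM ler_wpM2r.
Qed.

Lemma pow_le_exp c n (x : R) : 0 < c -> `|x| ^+ n <= n`!%:R / c ^+ n * expR (c * `|x|).
Proof.
move=> c0; rewrite mulrAC ler_pdivlMr ?exprn_gt0 // -exprMn mulrC.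
by rewrite exprn_le_exp // mulr_ge0 // ltW.
Qed.

Lemma L1_pow n : L1 P (fun w => f w ^+ n).
Proof.
apply: (L1_dominated _ _ (L1Z (n`!%:R / z0 ^+ n) e1)); first exact: measurable_funX.
by move=> w; rewrite normrX pow_le_exp.
Qed.

(** The margin between [z0 / 2] and [z0] absorbs the power of [f] in the Taylor
    remainder into the exponential. *)
Lemma mgf_taylor n z : `|z| <= z0 / 2 ->
  `|mean P (fun w => expR (z * f w)) -
    \sum_(k < n) z ^+ k * (mean P (fun w => f w ^+ k) / k`!%:R)| <=
  `|z| ^+ n * (n`!%:R / (z0 / 2) ^+ n * mean P (fun w => expR (z0 * `|f w|))).
Proof.
move=> zz; have c0 : 0 < z0 / 2 by rewrite divr_gt0.
have zz0 : `|z| <= z0 by apply: le_trans zz _; lra.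
have s1 : L1 P (fun w => \sum_(k < n) z ^+ k / k`!%:R * f w ^+ k).
  by apply: L1_sum => i; apply: L1Z; exact: L1_pow.
rewrite [X in _ - X](_ : _ = mean P (fun w => \sum_(k < n) z ^+ k / k`!%:R * f w ^+ k)).
  2:{ rewrite mean_sum; last by move=> i; apply: L1Z; exact: L1_pow.
      by apply: eq_bigr => k _; rewrite meanZ; [rewrite mulrA mulrAC|exact: L1_pow]. }
rewrite -meanB //; last exact: L1_exp.
have d1 := L1B (L1_exp zz0) s1.
apply: le_trans (le_normr_Rintegral measurableT d1) _.
rewrite mulrA -meanZ //; apply: le_mean => //.
- exact: integrable_norm.
- exact: L1Z.
move=> w /=.
have -> : \sum_(k < n) z ^+ k / k`!%:R * f w ^+ k =
    \sum_(0 <= k < n) (z * f w) ^+ k / k`!%:R.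
  by rewrite big_mkord; apply: eq_bigr => k _; rewrite exprMn mulrAC.
apply: le_trans (expR_taylor _ _) _; rewrite !normrM exprMn -!mulrA ler_wpM2l ?exprn_ge0 //.
apply: (@le_trans _ _ ((n`!%:R / (z0 / 2) ^+ n * expR (z0 / 2 * `|f w|)) *
  expR (z0 / 2 * `|f w|))).
  apply: ler_pM; rewrite ?exprn_ge0 ?expR_ge0 ?pow_le_exp //.
  by rewrite ler_expR ler_wpM2r.
by rewrite -[leLHS]mulrA -expRD -mulrDl -splitr -mulrA.
Qed.

End moments.

Section mgf_moments.
Context {R : realType} {d : measure_display} {T : measurableType d}.
Variable P : probability T R.

(** If the generating function is the inverse of a polynomial near 0, its Taylor
    coefficients are inverse to those of the polynomial: the product of a Taylor
    polynomial with [Q] differs from 1 by a small power of [z]. *)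
Lemma mgf_poly_inverse (f : T -> R) (z0 : R) (Q : {poly R}) :
  measurable_fun setT f -> 0 < z0 -> L1 P (fun w => expR (z0 * `|f w|)) ->
  (forall z, 0 < z <= z0 / 2 -> mean P (fun w => expR (z * f w)) * Q.[z] = 1) ->
  forall k, \sum_(i < k.+1) (mean P (fun w => f w ^+ i) / i`!%:R) * Q`_(k - i) =
    (k == 0%N)%:R.
Proof.
move=> mf z0_gt0 e1 mQ k; set mu := fun i => mean P (fun w => f w ^+ i) / i`!%:R.
pose M := \poly_(i < k.+1) mu i.
have c0 : 0 < z0 / 2 by rewrite divr_gt0.
have [B [B0 QB]] := horner_bounded Q (z0 / 2).
pose C := k.+1`!%:R / (z0 / 2) ^+ k.+1 * mean P (fun w => expR (z0 * `|f w|)).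
have H z : 0 < z <= z0 / 2 -> `|(M * Q - 1).[z]| <= C * B * z ^+ k.+1.
  move=> zz; have /andP[z_gt0 zle] := zz.
  have ez : `|z| = z by rewrite gtr0_norm.
  rewrite hornerD hornerM hornerN hornerC -(mQ z zz) -mulrBl normrM distrC.
  have -> : C * B * z ^+ k.+1 = (z ^+ k.+1 * C) * B by ring.
  apply: ler_pM => //; last exact: QB.
  have := @mgf_taylor _ _ _ P f z0 mf z0_gt0 e1 k.+1 z; rewrite ez => /(_ zle).
  apply: le_trans; rewrite le_eqVlt; apply/orP; left; apply/eqP.
  congr (`|_ - _|); rewrite horner_poly; apply: eq_bigr => i _.
  by rewrite mulrC.
have := coef_poly_bigO c0 H (ltnSn k).
rewrite coefB coefM coef1 => /eqP; rewrite subr_eq0 => /eqP <-.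
by apply: eq_bigr => i _; rewrite coef_poly ltn_ord.
Qed.

Section normal_moments.
Variables (v : R) (V : T -> R).
Hypothesis v0 : 0 < v.
Hypothesis mV : measurable_fun setT V.
Hypothesis nV : centred_normal P v V.

Lemma mgf_centred_normal z :
  ('E_P[(fun w => expR (z * V w))%R] = (expR (z ^+ 2 * v / 2))%:E)%E.
Proof.
have := @integral_normal_exp_quadratic R v z 0 v0; rewrite !mul0r subr0 ltr01 => /(_ isT).
rewrite sqrtr1 invr1 mul1r mulr1 => <-; rewrite unlock.
rewrite (ge0_integral_centred_normal (g := fun x => expR (z * x)) mV nV).
- by apply: eq_integral => x _; rewrite mul0r addr0.
- by apply: measurableT_comp => //; exact: measurable_funM.
- by move=> x; exact: expR_ge0.
Qed.

Lemma L1_exp_centred_normal z : L1 P (fun w => expR (z * V w)).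
Proof.
apply: ge0_L1.
- by apply: measurableT_comp => //; exact: measurable_funM.
- by move=> w; exact: expR_ge0.
- by rewrite mgf_centred_normal ltry.
Qed.

Lemma centred_normal_exp_abs : L1 P (fun w => expR (1 * `|V w|)).
Proof.
apply: L1_exp_abs => //; first exact: L1_exp_centred_normal.
by have := L1_exp_centred_normal (-1); under eq_fun do rewrite mulNr.
Qed.

Lemma centred_normal_pow n : L1 P (fun w => V w ^+ n).
Proof. exact: (L1_pow mV ltr01 centred_normal_exp_abs). Qed.

Lemma centred_normal_L2 : L2 P V.
Proof. by split=> //; exact: centred_normal_pow. Qed.

(** Read off from the expansion of [expR (z ^+ 2 * v / 2)] to second order. *)
Lemma centred_normal_mean_var : mean P V = 0 /\ mean P (fun w => V w ^+ 2) = v.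
Proof.
pose mu i := mean P (fun w => V w ^+ i) / i`!%:R.
pose M := \poly_(i < 3) mu i.
pose C := (3`!%:R / (1 / 2) ^+ 3 * mean P (fun w => expR (1 * `|V w|))).
pose C' := (v / 2) ^+ 2 * expR (v / 2).
have c0 : 0 < 1 / 2 :> R by rewrite divr_gt0.
pose p : {poly R} := M - (1 + (v / 2)%:P * 'X^2).
have H z : 0 < z <= 1 / 2 -> `|p.[z]| <= (C + C') * z ^+ 3.
  move=> /andP[z_gt0 zle]; have ez : `|z| = z by rewrite gtr0_norm.
  have z1 : z <= 1 by lra.
  have Mz : M.[z] = \sum_(k < 3) z ^+ k * mu k.
    by rewrite horner_poly; apply: eq_bigr => i _; rewrite mulrC.
  have mz : mean P (fun w => expR (z * V w)) = expR (z ^+ 2 * v / 2).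
    exact/mean_expectation/mgf_centred_normal.
  have := @mgf_taylor _ _ _ P V 1 mV ltr01 centred_normal_exp_abs 3%N z.
  rewrite ez => /(_ zle); rewrite -Mz mz -/C => H1.
  have := expR_taylor (z ^+ 2 * v / 2) 2%N.
  have u0 : 0 <= z ^+ 2 * v / 2 by rewrite divr_ge0 // mulr_ge0 ?sqr_ge0 ?ltW.
  rewrite (ger0_norm u0) big_ltn // big_ltn // big_geq // addr0 expr0 expr1 !divr1 => H2.
  have H3 : (z ^+ 2 * v / 2) ^+ 2 * expR (z ^+ 2 * v / 2) <= C' * z ^+ 3.
    rewrite /C' [leRHS]mulrAC; apply: ler_pM.
    - by rewrite sqr_ge0.
    - exact: expR_ge0.
    - have -> : (z ^+ 2 * v / 2) ^+ 2 = (v / 2) ^+ 2 * z ^+ 3 * z by ring.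
      rewrite -[leRHS]mulr1; apply: ler_wpM2l => //.
      by rewrite mulr_ge0 ?sqr_ge0 ?exprn_ge0 // ltW.
    - rewrite ler_expR -mulrA ler_piMl //; first by rewrite divr_ge0 // ltW.
      by rewrite exprn_ile1 // ltW.
  have -> : p.[z] = (M.[z] - expR (z ^+ 2 * v / 2)) +
      (expR (z ^+ 2 * v / 2) - (1 + z ^+ 2 * v / 2)).
    rewrite /p hornerD hornerN hornerD hornerM hornerC hornerC hornerXn; ring.
  apply: le_trans (ler_normD _ _) _; rewrite mulrDl; apply: lerD.
    by rewrite distrC (le_trans H1) // mulrC.
  exact: le_trans H2 H3.
have p1 := coef_poly_bigO c0 H (isT : (1 < 3)%N).
have p2 := coef_poly_bigO c0 H (isT : (2 < 3)%N).
have E k : (k < 3)%N -> p`_k = mu k - ((k == 0%N)%:R + v / 2 * (k == 2%N)%:R).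
  by move=> k3; rewrite /p coefB coef_poly k3 coefD coef1 coefCM coefXn.
move: p1 p2; rewrite !E //= /mu /= !mulr0 !mulr1 !add0r !subr0.
have -> : 1`!%:R = 1 :> R by [].
rewrite divr1 => m1 m2; split.
  by rewrite -[RHS]m1; congr mean; apply/funext => w; rewrite expr1.
have : 2`!%:R = 2 :> R by [].
by move=> e; move: m2; rewrite e; lra.
Qed.

End normal_moments.
End mgf_moments.

(** * Moments of the discrete area *)

Section complex_power.
Context {R : realType}.
Implicit Types (c : nat -> R) (w : R).

(** The Taylor coefficients of cos and sin, up to factorials. *)
Definition cos_sign (i : nat) : R := if odd i then 0 else (-1) ^+ i./2.
Definition sin_sign (i : nat) : R := if odd i then (-1) ^+ i./2 else 0.

Lemma cos_signS i : cos_sign i.+1 = - sin_sign i.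
Proof.
rewrite /cos_sign /sin_sign /= uphalf_half; case: (odd i) => /=; last by rewrite oppr0.
by rewrite add1n exprS mulN1r.
Qed.

Lemma sin_signS i : sin_sign i.+1 = cos_sign i.
Proof.
rewrite /cos_sign /sin_sign /= uphalf_half; case: (odd i) => //=.
Qed.

Definition binomial_sum c k w := \sum_(i < k.+1) c i * 'C(k, i)%:R * w ^+ i.

Lemma binomial_sumS c k w :
  binomial_sum c k.+1 w = binomial_sum c k w + w * binomial_sum (c \o succn) k w.
Proof.
rewrite /binomial_sum big_ord_recl /= bin0.
under eq_bigr => i _ do
  rewrite /bump /= add1n binS natrD mulrDr mulrDl.
rewrite big_split /= addrA; congr (_ + _).
  rewrite [RHS]big_ord_recl /= bin0; congr (_ + _).
  by rewrite big_ord_recr /= bin_small // mulr0 mul0r addr0.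
rewrite mulr_sumr; apply: eq_bigr => i _; rewrite exprS; ring.
Qed.

(** Real and imaginary parts of [(1 + i w) ^ k]. *)
Definition re_pow k w := binomial_sum cos_sign k w.
Definition im_pow k w := binomial_sum sin_sign k w.

Lemma re_powS k w : re_pow k.+1 w = re_pow k w - w * im_pow k w.
Proof.
rewrite /re_pow binomial_sumS -mulrN; congr (_ + _ * _).
by rewrite /im_pow /binomial_sum -sumrN; apply: eq_bigr => i _ /=;
  rewrite cos_signS !mulNr.
Qed.

Lemma im_powS k w : im_pow k.+1 w = im_pow k w + w * re_pow k w.
Proof.
rewrite /im_pow binomial_sumS; congr (_ + _ * _).
by apply: eq_bigr => i _ /=; rewrite sin_signS.
Qed.

Lemma re_pow0 w : re_pow 0 w = 1.
Proof. by rewrite /re_pow /binomial_sum big_ord1 /cos_sign /= bin0 !mulr1. Qed.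

Lemma im_pow0 w : im_pow 0 w = 0.
Proof. by rewrite /im_pow /binomial_sum big_ord1 /sin_sign /= !mul0r. Qed.

(** For [k * |w| <= 1 / 2] the point (1 + i w)^k stays away from the imaginary
    axis; the constants are chosen so that both bounds propagate together. *)
Lemma re_im_pow_bound k w : k%:R * `|w| <= 1 / 2 ->
  `|re_pow k w - 1| <= 3 / 4 * (k%:R * `|w|) /\ `|im_pow k w| <= 3 / 2 * (k%:R * `|w|).
Proof.
elim: k => [|k IH]; first by rewrite re_pow0 im_pow0 subrr !normr0 mul0r !mulr0.
rewrite -natr1 mulrDl mul1r => kw.
have w0 : 0 <= `|w| by [].
have kw0 : 0 <= k%:R * `|w| by rewrite mulr_ge0.
have [|qb sb] := IH; first lra.
have q2 : `|re_pow k w| <= 3 / 2.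
  have : `|re_pow k w| <= `|re_pow k w - 1| + 1.
    by rewrite -[X in `|X| <= _](subrK 1) (le_trans (ler_normD _ _)) // normr1.
  lra.
have s1 : `|im_pow k w| <= 3 / 4 by lra.
rewrite re_powS im_powS; split.
  have : `|re_pow k w - w * im_pow k w - 1| <= `|re_pow k w - 1| + `|w| * `|im_pow k w|.
    by rewrite addrAC -normrM; exact: ler_normB.
  have : `|w| * `|im_pow k w| <= `|w| * (3 / 4) by rewrite ler_wpM2l.
  lra.
have : `|im_pow k w + w * re_pow k w| <= `|im_pow k w| + `|w| * `|re_pow k w|.
  by rewrite -normrM; exact: ler_normD.
have : `|w| * `|re_pow k w| <= `|w| * (3 / 2) by rewrite ler_wpM2l.
lra.
Qed.

Lemma re_pow_ge k w : k%:R * `|w| <= 1 / 2 -> 1 / 2 <= re_pow k w.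
Proof.
move=> kw; have [h _] := re_im_pow_bound kw; move: h; rewrite ler_norml => /andP[h _].
lra.
Qed.

End complex_power.

Section discrete_area_moments.
Context {R : realType} {d : measure_display} {T : measurableType d}.
Variables (P : probability T R) (D : set R) (X Y : R -> {RV P >-> R}).
Hypothesis pXY : planar_brownian_motion D X Y.
Variables (t : nat -> R) (N : nat) (dt : R).
Hypothesis dt0 : 0 < dt.
Hypothesis Dt : forall k, (k <= N)%N -> D (t k).
Hypothesis tS : forall k, t k.+1 = t k + dt.

Let A w := path_area (fun i => X (t i) w) (fun i => Y (t i) w) N.

Lemma measurable_discrete_area : measurable_fun setT A.
Proof. exact: measurable_path_area. Qed.

(** The recursion of [expectation_exp_area] started at (1, 0) runs through the
    powers of 1 + i z dt / 2. *)
Lemma mgf_discrete_area z : N%:R * (`|z| * dt) <= 1 ->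
  ('E_P[(fun w => expR (z * A w))%R] = ((re_pow N (z * dt / 2))^-1)%:E)%E.
Proof.
move=> zN; set u := z * dt / 2.
have uN k : (k <= N)%N -> k%:R * `|u| <= 1 / 2.
  move=> kN; have -> : `|u| = `|z| * dt / 2 by rewrite /u 2!normrM (gtr0_norm dt0) (ger0_norm (_ : 0 <= 2^-1)).
  rewrite mulrA ler_pM2r // (le_trans _ zN) // ler_wpM2r ?ler_nat //.
  by rewrite mulr_ge0 // ltW.
have := @expectation_exp_area R d T P D X Y pXY t N dt dt0 Dt tS z
  (fun k => re_pow k u) (fun k => im_pow k u) N 0.
move=> /(_ (fun k => re_powS k u) (fun k => im_powS k u) _ (leqnn N)).
rewrite add0n re_pow0 im_pow0 !mul0r => H.
rewrite -div1r -H; last first.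
  by move=> i iN; apply: lt_le_trans (re_pow_ge (uN _ iN)).
by congr ('E_P[_])%E; apply/funext => o; rewrite mulr0 mul0r addr0.
Qed.

Lemma mgf_discrete_area_le2 z : N%:R * (`|z| * dt) <= 1 ->
  ('E_P[(fun w => expR (z * A w))%R] <= 2%:E)%E.
Proof.
move=> zN; rewrite mgf_discrete_area // lee_fin.
suff h : 1 / 2 <= re_pow N (z * dt / 2).
  by rewrite -div1r ler_pdivrMr; lra.
apply: re_pow_ge; rewrite !normrM (gtr0_norm dt0) (ger0_norm (_ : 0 <= 2^-1)) //.
by rewrite mulrA ler_pM2r.
Qed.

Lemma exp_abs_discrete_area z : 0 < z -> N%:R * (z * dt) <= 1 ->
  L1 P (fun w => expR (z * `|A w|)) /\
  mean P (fun w => expR (z * `|A w|)) <= 2 + 2.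
Proof.
move=> z0 zN; apply: exp_abs_le; first exact: measurable_discrete_area.
  by apply: mgf_discrete_area_le2; rewrite gtr0_norm.
under eq_fun do rewrite -mulNr.
by apply: mgf_discrete_area_le2; rewrite normrN gtr0_norm.
Qed.

(** Here the coefficients of the denominator are written out as functions of the
    number of steps, ready for the passage to the limit. *)
Lemma discrete_area_moments k :
  \sum_(i < k.+1) (mean P (fun w => A w ^+ i) / i`!%:R) *
    (cos_sign (k - i) * 'C(N, k - i)%:R * (dt / 2) ^+ (k - i)) = (k == 0%N)%:R.
Proof.
have N0 : 0 < N.+1%:R :> R by rewrite ltr0n.
pose z0 := (N.+1%:R * dt)^-1.
have z0_gt0 : 0 < z0 by rewrite invr_gt0 mulr_gt0.
have zN z : 0 <= z <= z0 -> N%:R * (z * dt) <= 1.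
  move=> /andP[z_ge0 zz0]; rewrite mulrCA.
  apply: (@le_trans _ _ (z0 * (N.+1%:R * dt))); last by rewrite mulVf // gt_eqF // mulr_gt0.
  apply: ler_pM => //; first by rewrite mulr_ge0 // ltW.
  by rewrite ler_pM2r // ler_nat.
pose Q := \poly_(i < N.+1) (cos_sign i * 'C(N, i)%:R * (dt / 2) ^+ i).
have := @mgf_poly_inverse _ _ _ P A z0 Q measurable_discrete_area z0_gt0.
have [|e1 _] := exp_abs_discrete_area z0_gt0 (zN z0 _).
  by rewrite lexx ltW.
move=> /(_ e1) h.
rewrite -h.
  apply: eq_bigr => i _; congr (_ * _); rewrite coef_poly; case: ltnP => // kN.
  by rewrite bin_small // mulr0 mul0r.
move=> z /andP[z_gt0 zz].
have zz0 : z <= z0 by apply: le_trans zz _; lra.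
have nz : N%:R * (`|z| * dt) <= 1 by rewrite gtr0_norm // zN // zz0 ltW.
rewrite (mean_expectation (mgf_discrete_area nz)).
have -> : Q.[z] = re_pow N (z * dt / 2).
  rewrite horner_poly; apply: eq_bigr => i _.
  have -> : z * dt / 2 = dt / 2 * z by ring.
  by rewrite (exprMn _ (dt / 2) z) mulrA.
rewrite mulVf // gt_eqF //; apply: lt_le_trans (re_pow_ge _) => //.
rewrite !normrM (gtr0_norm dt0) (ger0_norm (_ : 0 <= 2^-1)) //.
by rewrite mulrA ler_pM2r.
Qed.

End discrete_area_moments.

(** * The isometry for integrals over one partition *)

Section increments.
Context {R : realType} {d : measure_display} {T : measurableType d}.
Variables (P : probability T R) (D : set R).
Implicit Types (W Z : R -> {RV P >-> R}).

Lemma bm_incr W s t : brownian_motion D W -> D s -> D t -> s <= t ->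
  [/\ L2 P (fun w => W t w - W s w), mean P (fun w => W t w - W s w) = 0
    & mean P (fun w => (W t w - W s w) ^+ 2) = t - s].
Proof.
move=> bW Ds Dt; rewrite le_eqVlt => /predU1P[<-|st].
  under eq_fun do rewrite subrr.
  split; [exact: L2_cst|exact: mean_cst|].
  by under eq_fun do rewrite subrr expr0n /=; rewrite mean_cst subrr.
have v0 : 0 < t - s by rewrite subr_gt0.
have mV : measurable_fun setT (fun w => W t w - W s w) by exact: measurable_funB.
have nV : centred_normal P (t - s) (fun w => W t w - W s w).
  by move=> B mB; exact: (bm_normal_incr bW Ds Dt st).
have [m0 m2] := centred_normal_mean_var v0 mV nV.
split=> //; exact: centred_normal_L2 v0 mV nV.
Qed.

Lemma joint_pastS W Z s t : s <= t -> joint_past D W Z s `<=` joint_past D W Z t.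
Proof.
move=> st; apply: sub_sigma_algebra2 => A [WA|ZA]; [left|by right].
apply: sigma_genS WA => u [Du] /=; rewrite !in_itv /= => us; split => //=.
exact: le_trans us st.
Qed.

Lemma adaptedM (G : set (set T)) (f g : T -> R) :
  adapted <<s G>> f -> adapted <<s G>> g -> adapted <<s G>> (fun w => f w * g w).
Proof. by rewrite !adaptedE => mf mg; exact: measurable_funM. Qed.

Lemma adaptedD (G : set (set T)) (f g : T -> R) :
  adapted <<s G>> f -> adapted <<s G>> g -> adapted <<s G>> (fun w => f w + g w).
Proof. by rewrite !adaptedE => mf mg; exact: measurable_funD. Qed.

Lemma adapted_subr (G : set (set T)) (f g : T -> R) :
  adapted <<s G>> f -> adapted <<s G>> g -> adapted <<s G>> (fun w => f w - g w).
Proof. by rewrite !adaptedE => mf mg; exact: measurable_funB. Qed.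

Lemma L2_indepM U V : L2 P U -> L2 P V -> indep_rv P U V -> L2 P (fun w => U w * V w).
Proof.
move=> [mU U2] [mV V2] UV; split; first exact: measurable_funM.
under eq_fun do rewrite exprMn.
have m2 : measurable_fun setT (fun x : R => x ^+ 2) by exact: measurable_funX.
apply: (L1_indepM U2 V2); exact: (indep_rv_comp m2 m2 UV).
Qed.

(** Itô's isometry for one partition: each new term is orthogonal to the sum of
    the previous ones, as the increment of W is centred and independent of the
    past. *)
Lemma ito_isometry W Z (t : nat -> R) (U : nat -> T -> R) n :
  brownian_motion D W -> indep P (sigma_gen D W) (sigma_gen D Z) ->
  (forall k, (k <= n)%N -> D (t k)) -> (forall k, (k < n)%N -> t k < t k.+1) ->
  (forall k, (k < n)%N -> adapted (joint_past D W Z (t k)) (U k)) ->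
  (forall k, (k < n)%N -> L2 P (U k)) ->
  let M w := \sum_(k < n) U k w * (W (t k.+1) w - W (t k) w) in
  [/\ adapted (joint_past D W Z (t n)) M, L2 P M &
      mean P (fun w => M w ^+ 2) =
      \sum_(k < n) mean P (fun w => U k w ^+ 2) * (t k.+1 - t k)].
Proof.
move=> bW WZ; elim: n => [|n IH] Dt tS aU U2 M.
  have -> : M = fun=> 0 by apply/funext => w; rewrite /M big_ord0.
  split; [|exact: L2_cst|].
    by rewrite adaptedE; exact: measurable_cst.
  by rewrite expr0n /= mean_cst big_ord0.
pose M' w := \sum_(k < n) U k w * (W (t k.+1) w - W (t k) w).
have [k kn|k kn|k kn|k kn|aM' M'2 M'E] := IH.
- by apply: Dt; exact: leqW.
- by apply: tS; exact: ltnW.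
- by apply: aU; exact: ltnW.
- by apply: U2; exact: ltnW.
rewrite -/M' in aM' M'2 M'E.
pose V w := W (t n.+1) w - W (t n) w.
have tn : t n < t n.+1 by exact: tS.
have Dn : D (t n) by exact: Dt.
have Dn1 : D (t n.+1) by exact: Dt.
have [V2 V0 Vv] := bm_incr bW Dn Dn1 (ltW tn).
rewrite -/V in V2 V0 Vv.
have iV : indep_of P (joint_past D W Z (t n)) V by exact: indep_joint_past.
have aUn : adapted (joint_past D W Z (t n)) (U n) by exact: aU.
have Un2 : L2 P (U n) by exact: U2.
have ME : M = fun w => M' w + U n w * V w.
  by apply/funext => w; rewrite /M big_ord_recr.
have UV2 : L2 P (fun w => U n w * V w).
  by apply: L2_indepM => //; exact: indep_of_rv iV aUn.
split.
- rewrite ME; apply: adaptedD.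
    by apply: adapted_sub aM'; apply: joint_pastS; exact: ltW.
  apply: adaptedM; first by apply: adapted_sub aUn; apply: joint_pastS; exact: ltW.
  by apply: adapted_subr; apply: adapted_bm => //; exact: ltW.
- by rewrite ME; exact: L2D.
have MU1 := L2M M'2 Un2.
have iMU : indep_rv P (fun w => M' w * U n w) V.
  by apply: indep_of_rv iV _; exact: adaptedM.
have MUV1 := L1_indepM MU1 (L2_L1 V2) iMU.
have MUV0 : mean P (fun w => M' w * U n w * V w) = 0.
  by rewrite mean_indepM // ?V0 ?mulr0 //; exact: L2_L1.
have m2 : measurable_fun setT (fun x : R => x ^+ 2) by exact: measurable_funX.
have iU2 : indep_rv P (fun w => U n w ^+ 2) (fun w => V w ^+ 2).
  exact: (indep_rv_comp m2 m2 (indep_of_rv iV aUn)).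
transitivity (mean P (fun w => M' w ^+ 2 + 2 * (M' w * U n w * V w) +
    U n w ^+ 2 * V w ^+ 2)).
  by congr mean; apply/funext => w; rewrite ME; ring.
have U2V2 := L1_indepM (L2_sqr Un2) (L2_sqr V2) iU2.
have s1 : L1 P (fun w => M' w ^+ 2 + 2 * (M' w * U n w * V w)).
  by apply: L1D; [exact: L2_sqr|exact: L1Z].
rewrite meanD // meanD //; [|exact: L2_sqr|exact: L1Z].
rewrite meanZ // MUV0 mulr0 addr0 M'E big_ord_recr /=; congr (_ + _).
by rewrite mean_indepM ?Vv //; exact: L2_sqr.
Qed.

End increments.

(** * Time integrals over a partition *)

Section partition_integral.
Context {R : realType}.
Notation mu := (@lebesgue_measure R).

Lemma itv_co_setU (x y z : R) : x <= y -> y <= z ->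
  `[x, z[%classic = `[x, y[%classic `|` `[y, z[%classic.
Proof.
move=> xy yz; apply/seteqP; split=> u /=; rewrite !in_itv /=.
  move=> /andP[xu uz]; case: (ltP u y) => uy; [left|right]; apply/andP; split => //.
by move=> [/andP[xu uy]|/andP[yu uz]]; apply/andP; split => //;
  [exact: lt_le_trans yz|exact: le_trans yu].
Qed.

Lemma itv_co_disj (x y z : R) : [disjoint `[x, y[%classic & `[y, z[%classic].
Proof.
apply/disj_setPS => u [] /=; rewrite !in_itv /= => /andP[_ uy] /andP[yu _].
by move: (lt_le_trans uy yu); rewrite ltxx.
Qed.

(** Bounding the affine function from below by its value at the start on the
    first half and by its value at the midpoint on the second half loses only
    half of the quadratic term. *)
Lemma integral_affine_ge (x y e : R) (f : R -> \bar R) : x < y -> 0 <= e ->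
  (forall u, x <= u < y -> f u = (e + (u - x))%:E) ->
  measurable_fun `[x, y[ f /\
  ((e * (y - x) + (y - x) ^+ 2 / 4)%:E <= \int[mu]_(u in `[x, y[) f u)%E.
Proof.
move=> xy e0 fE.
have mf : measurable_fun `[x, y[ f.
  apply: (@eq_measurable_fun _ _ _ _ _ (fun u : R => (e + (u - x))%:E)).
    by move=> u; rewrite inE /= in_itv /= => ?; rewrite fE.
  apply/measurable_EFinP; apply: measurable_funTS.
  by apply: measurable_funD => //; apply: measurable_funB.
split=> //.
pose m := (x + y) / 2.
have xm : x < m by rewrite /m; lra.
have my : m < y by rewrite /m; lra.
rewrite (itv_co_setU (ltW xm) (ltW my)) in mf *.
rewrite ge0_integral_setU //=; last 2 first.
- move=> u uU; have xuy : x <= u < y.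
    by case: uU; rewrite /= in_itv /= => /andP[? ?]; apply/andP; split; lra.
  by rewrite fE // lee_fin; case/andP: xuy => ? ?; lra.
- exact: itv_co_disj.
have [mf1 mf2] := (measurable_funU f (measurable_itv _) (measurable_itv _)).1 mf.
have -> : (e * (y - x) + (y - x) ^+ 2 / 4)%:E =
    ((e * (m - x))%:E + ((e + (m - x)) * (y - m))%:E)%E.
  by rewrite -EFinD; congr EFin; rewrite /m; field.
apply: leeD.
- have -> : (e * (m - x))%:E = (\int[mu]_(u in `[x, m[) (cst e%:E) u)%E.
    by rewrite integral_cst //= lebesgue_measure_itv /= lte_fin xm -EFinB -EFinM.
  apply: ge0_le_integral => //=.
  + move=> u; rewrite in_itv /= => /andP[xu um].
    by rewrite fE ?xu ?(lt_trans um) // lee_fin; lra.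
- have -> : ((e + (m - x)) * (y - m))%:E =
     (\int[mu]_(u in `[m, y[) (cst (e + (m - x))%:E) u)%E.
    by rewrite integral_cst //= lebesgue_measure_itv /= lte_fin my -EFinB -EFinM.
  apply: ge0_le_integral => //=.
  + by move=> u; rewrite lee_fin; lra.
  + move=> u; rewrite in_itv /= => /andP[mu1 uy].
    by rewrite fE ?uy ?(le_trans (ltW xm)) // lee_fin; lra.
Qed.

(** The lower bounds and the measurability add up along the steps. *)
Lemma integral_partition_ge (t e : nat -> R) (f : R -> \bar R) n :
  (forall k, (k < n)%N -> t k < t k.+1) -> (forall k, (k < n)%N -> 0 <= e k) ->
  (forall k, (k < n)%N -> forall u, t k <= u < t k.+1 -> f u = (e k + (u - t k))%:E) ->
  t 0%N <= t n /\ (forall u, t 0%N <= u < t n -> (0 <= f u)%E) /\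
  measurable_fun `[t 0%N, t n[ f /\
  ((\sum_(k < n) (e k * (t k.+1 - t k) + (t k.+1 - t k) ^+ 2 / 4))%:E <=
    \int[mu]_(u in `[t 0%N, t n[) f u)%E.
Proof.
elim: n => [|n IH] tS e0 fE.
  split=> //; split; first by move=> u /andP[ut tu]; move: (le_lt_trans ut tu); rewrite ltxx.
  by rewrite set_itvco0 // integral_set0 big_ord0; split => //; exact: measurable_fun_set0.
have [k kn|k kn|k kn|t0n [f0 [mf I1]]] := IH; [exact/tS/ltnW|exact/e0/ltnW|exact/fE/ltnW|].
have tn := tS n (ltnSn n).
have [mfn In] := integral_affine_ge tn (e0 n (ltnSn n)) (fE n (ltnSn n)).
have f0' u : t 0%N <= u < t n.+1 -> (0 <= f u)%E.
  move=> /andP[tu ut]; case: (ltP u (t n)) => un; first by rewrite f0 // tu.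
  by rewrite (fE n) // ?un // lee_fin addr_ge0 ?e0 // subr_ge0.
split; first by rewrite (le_trans t0n) // ltW.
split => //; rewrite (itv_co_setU t0n (ltW tn)); split.
  by apply/measurable_funU => //; split.
rewrite ge0_integral_setU //=; last 3 first.
- by apply/measurable_funU => //; split.
- move=> u uU; apply: f0'.
  by case: uU; rewrite /= in_itv /= => /andP[? ?]; apply/andP; split; lra.
- exact: itv_co_disj.
by rewrite big_ord_recr EFinD; exact: leeD.
Qed.

End partition_integral.

(** * Riemann sums over two partitions *)

Section overlap.
Context {R : realType}.
Implicit Types (p q : R) (t u : nat -> R).

(** The length of the intersection of the intervals from p to q and from p' to
    q', in the form in which it is the covariance of two Brownian increments. *)
Definition overlap p q p' q' :=
  Num.min q q' - Num.min q p' - (Num.min p q' - Num.min p p').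

(** Either the intervals do not meet, and both sides vanish, or the distance of
    their left endpoints is at most the length of one of them. *)
Lemma overlap_bound p q p' q' : p <= q -> p' <= q' ->
  overlap p q p' q' * (p + p' - 2 * Num.min p p') <=
  overlap p q p' q' * ((q - p) + (q' - p')).
Proof.
move=> pq pq'; rewrite /overlap.
case: (lerP q q') => h1; case: (lerP q p') => h2; case: (lerP p q') => h3;
  case: (lerP p p') => h4; try nra; exfalso; lra.
Qed.

Lemma overlap_sumr p q u m : p <= q -> u 0%N <= p -> q <= u m ->
  \sum_(l < m) overlap p q (u l) (u l.+1) = q - p.
Proof.
move=> pq u0 um.
pose f l := Num.min q (u l) - Num.min p (u l).
rewrite (eq_bigr (fun l : 'I_m => f l.+1 - f l)); last first.
  by move=> l _; rewrite /overlap /f; ring.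
rewrite -(big_mkord xpredT (fun l => f l.+1 - f l)) telescope_sumr // /f.
rewrite (min_l um) (min_l (le_trans pq um)).
by rewrite (min_r u0) (min_r (le_trans u0 pq)) subrr subr0.
Qed.

Lemma overlapC p q p' q' : overlap p q p' q' = overlap p' q' p q.
Proof.
rewrite /overlap (minC q q') (minC q p') (minC p q') (minC p p'); ring.
Qed.

Lemma partition_le t n : (forall k, (k < n)%N -> t k < t k.+1) ->
  forall i j, (i <= j <= n)%N -> t i <= t j.
Proof.
move=> tS i; elim=> [|j IH] /andP[ij jn]; first by move: ij; rewrite leqn0 => /eqP ->.
move: ij; rewrite leq_eqVlt => /predU1P[->//|ij].
by rewrite (le_trans (IH _)) ?(ltW (tS _ _)) // -ltnS ij ltnW.
Qed.

(** Splitting both single sums along the common refinement, the left-hand side is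
    the sum of overlaps weighted by the distance of left endpoints. *)
Lemma partition_distance t u n m :
  t 0%N = u 0%N -> t n = u m ->
  (forall k, (k < n)%N -> t k < t k.+1) -> (forall k, (k < m)%N -> u k < u k.+1) ->
  \sum_(k < n) (t k - t 0%N) * (t k.+1 - t k) +
  \sum_(l < m) (u l - u 0%N) * (u l.+1 - u l) -
  2 * (\sum_(k < n) \sum_(l < m) (Num.min (t k) (u l) - t 0%N) *
     overlap (t k) (t k.+1) (u l) (u l.+1)) <=
  \sum_(k < n) (t k.+1 - t k) ^+ 2 + \sum_(l < m) (u l.+1 - u l) ^+ 2.
Proof.
move=> t0 tn tS uS; have tle := partition_le tS; have ule := partition_le uS.
have S1 (c : nat -> R) : \sum_(k < n) c k * (t k.+1 - t k) =
    \sum_(k < n) \sum_(l < m) c k * overlap (t k) (t k.+1) (u l) (u l.+1).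
  apply: eq_bigr => k _; rewrite -mulr_sumr overlap_sumr //.
  - exact/ltW/tS.
  - by rewrite -t0; apply: tle; rewrite leq0n (ltnW (ltn_ord k)).
  - by rewrite -tn; apply: tle; rewrite ltn_ord leqnn.
have S2 (c : nat -> R) : \sum_(l < m) c l * (u l.+1 - u l) =
    \sum_(k < n) \sum_(l < m) c l * overlap (t k) (t k.+1) (u l) (u l.+1).
  rewrite exchange_big; apply: eq_bigr => l _; rewrite -mulr_sumr.
  congr (_ * _); apply/esym; under eq_bigr do rewrite overlapC.
  rewrite overlap_sumr //.
  - exact/ltW/uS.
  - by rewrite t0; apply: ule; rewrite leq0n (ltnW (ltn_ord l)).
  - by rewrite tn; apply: ule; rewrite ltn_ord leqnn.
rewrite (S1 (fun k => t k - t 0%N)) (S2 (fun l => u l - u 0%N)).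
under [X in _ <= X + _]eq_bigr do rewrite expr2.
under [X in _ <= _ + X]eq_bigr do rewrite expr2.
rewrite (S1 (fun k => t k.+1 - t k)) (S2 (fun l => u l.+1 - u l)).
rewrite mulr_sumr -sumrN -!big_split /=; apply: ler_sum => k _.
rewrite mulr_sumr -sumrN -!big_split /=; apply: ler_sum => l _.
have := @overlap_bound (t k) (t k.+1) (u l) (u l.+1) (ltW (tS _ (ltn_ord k)))
  (ltW (uS _ (ltn_ord l))).
rewrite t0; move: (overlap _ _ _ _) (Num.min _ _) => o M; lra.
Qed.

End overlap.

Section riemann_sums.
Context {R : realType} {d : measure_display} {T : measurableType d}.
Variables (P : probability T R) (D : set R).
Implicit Types (W Z : R -> {RV P >-> R}).

Lemma bm_covariance W Z a s t : brownian_motion D W ->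
  indep P (sigma_gen D W) (sigma_gen D Z) ->
  D a -> D s -> D t -> a <= s -> a <= t ->
  mean P (fun w => (W s w - W a w) * (W t w - W a w)) = Num.min s t - a.
Proof.
move=> bW WZ Da; suff H s' t' : D s' -> D t' -> a <= s' -> s' <= t' ->
    mean P (fun w => (W s' w - W a w) * (W t' w - W a w)) = s' - a.
  move=> Ds Dt as_ at_; case: (lerP s t) => st; first exact: H.
  rewrite -(H t s) //; last exact: ltW.
  by congr mean; apply/funext => w; rewrite mulrC.
move=> Ds Dt as_; rewrite le_eqVlt => /predU1P[<-|st].
  have [_ _ <-] := bm_incr bW Da Ds as_.
  by congr mean; apply/funext => w; rewrite expr2.
have [U2 _ Uv] := bm_incr bW Da Ds as_.
have [V2 V0 _] := bm_incr bW Ds Dt (ltW st).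
have UV : indep_rv P (fun w => W s' w - W a w) (fun w => W t' w - W s' w).
  apply: indep_of_rv (indep_joint_past bW WZ Ds Dt st) _.
  by apply: adapted_subr; apply: adapted_bm.
have UV0 := mean_indepM (L2_L1 U2) (L2_L1 V2) UV.
transitivity (mean P (fun w => (W s' w - W a w) ^+ 2 +
    (W s' w - W a w) * (W t' w - W s' w))).
  by congr mean; apply/funext => w; ring.
by rewrite meanD ?UV0 ?V0 ?mulr0 ?addr0 //; [exact: L2_sqr|exact: L2M].
Qed.

Lemma bm_incr_overlap W Z a p q p' q' : brownian_motion D W ->
  indep P (sigma_gen D W) (sigma_gen D Z) ->
  D a -> D p -> D q -> D p' -> D q' -> a <= p -> a <= q -> a <= p' -> a <= q' ->
  mean P (fun w => (W q w - W p w) * (W q' w - W p' w)) = overlap p q p' q'.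
Proof.
move=> bW WZ Da Dp Dq Dp' Dq' ap aq ap' aq'.
pose B s w := W s w - W a w.
have B2 s : D s -> a <= s -> L2 P (B s) by move=> Ds as_; have [] := bm_incr bW Da Ds as_.
have C s t : D s -> D t -> a <= s -> a <= t ->
    mean P (fun w => B s w * B t w) = Num.min s t - a.
  exact: (bm_covariance bW WZ Da).
transitivity (mean P (fun w => (B q w * B q' w - B q w * B p' w) -
    (B p w * B q' w - B p w * B p' w))).
  by congr mean; apply/funext => w; rewrite /B; ring.
rewrite meanB; [|by apply: L1B; apply: L2M; apply: B2..].
rewrite !meanB ?C //; [|by apply: L2M; apply: B2..].
by rewrite /overlap; ring.
Qed.

Section two_partitions.
Variables (Z W : R -> {RV P >-> R}) (a b : R).
Hypothesis pZW : planar_brownian_motion D Z W.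

Definition is_partition (t : nat -> R) n := [/\ t 0%N = a, t n = b,
  forall k, (k < n)%N -> t k < t k.+1 & forall k, (k <= n)%N -> D (t k)].

Definition riemann t n w := path_sum (fun i => Z (t i) w) (fun i => W (t i) w) n.

Lemma riemann_isometry t n : is_partition t n -> L2 P (riemann t n) /\
  mean P (fun w => riemann t n w ^+ 2) =
  \sum_(k < n) (t k - t 0%N) * (t k.+1 - t k).
Proof.
move=> [t0 tn tS Dt]; have [bZ bW ZW] := pZW.
have [_ _ WZ] := planar_brownian_motionC pZW.
have tle := partition_le tS.
have U k : (k < n)%N -> [/\ L2 P (fun w => Z (t k) w - Z (t 0%N) w),
    mean P (fun w => Z (t k) w - Z (t 0%N) w) = 0 &
    mean P (fun w => (Z (t k) w - Z (t 0%N) w) ^+ 2) = t k - t 0%N].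
  move=> kn; apply: (bm_incr bZ); [exact: Dt|exact/Dt/ltnW|].
  by apply: tle; rewrite leq0n ltnW.
have [k kn|k kn|_ J2 JE] := @ito_isometry _ _ _ _ _ W Z t
    (fun k w => Z (t k) w - Z (t 0%N) w) n bW WZ Dt tS.
- by apply: adapted_subr; apply: adapted_bm_snd; apply: Dt => //; exact: ltnW.
- by have [] := U k kn.
split=> //; rewrite JE; apply: eq_bigr => k _; congr (_ * _).
by have [] := U k (ltn_ord k).
Qed.

(** Independence of the two components factors each term into a covariance of
    values of [Z] and a covariance of increments of [W]. *)
Lemma riemann_cross t u n m : is_partition t n -> is_partition u m ->
  L1 P (fun w => riemann t n w * riemann u m w) /\
  mean P (fun w => riemann t n w * riemann u m w) =
  \sum_(k < n) \sum_(l < m) (Num.min (t k) (u l) - t 0%N) *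
     overlap (t k) (t k.+1) (u l) (u l.+1).
Proof.
move=> pt pu; split; first by apply: L2M; [have [] := riemann_isometry pt|
  have [] := riemann_isometry pu].
case: pt pu => [t0 tn tS Dt] [u0 um uS Du]; have [bZ bW ZW] := pZW.
have [_ _ WZ] := planar_brownian_motionC pZW.
have tle := partition_le tS; have ule := partition_le uS.
have Da : D a by rewrite -t0; exact: Dt.
have at_ k : (k <= n)%N -> a <= t k by move=> kn; rewrite -t0 tle // leq0n.
have au l : (l <= m)%N -> a <= u l by move=> lm; rewrite -u0 ule // leq0n.
pose HH k l w := (Z (t k) w - Z a w) * (Z (u l) w - Z a w).
pose dd k l w := (W (t k.+1) w - W (t k) w) * (W (u l.+1) w - W (u l) w).
have HH1 k l : (k < n)%N -> (l < m)%N -> L1 P (HH k l).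
  move=> kn lm; apply: L2M.
    by have [] := bm_incr bZ Da (Dt _ (ltnW kn)) (at_ _ (ltnW kn)).
  by have [] := bm_incr bZ Da (Du _ (ltnW lm)) (au _ (ltnW lm)).
have dd1 k l : (k < n)%N -> (l < m)%N -> L1 P (dd k l).
  move=> kn lm; apply: L2M.
    by have [] := bm_incr bW (Dt _ (ltnW kn)) (Dt _ kn) (ltW (tS _ kn)).
  by have [] := bm_incr bW (Du _ (ltnW lm)) (Du _ lm) (ltW (uS _ lm)).
have Hd k l : (k < n)%N -> (l < m)%N -> indep_rv P (HH k l) (dd k l).
  move=> kn lm A B mA mB; apply: ZW.
    apply: adaptedM (mA); apply: adapted_subr; apply: sigma_gen_adapted => //.
      exact/Dt/ltnW.
    exact/Du/ltnW.
  apply: adaptedM (mB); apply: adapted_subr; apply: sigma_gen_adapted;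
    by [exact: Dt|exact/Dt/ltnW|exact: Du|exact/Du/ltnW].
transitivity (mean P (fun w => \sum_(k < n) \sum_(l < m) HH k l w * dd k l w)).
  congr mean; apply/funext => w; rewrite /riemann /path_sum mulr_suml.
  apply: eq_bigr => k _; rewrite mulr_sumr; apply: eq_bigr => l _.
  by rewrite /HH /dd t0 u0; ring.
rewrite mean_sum => [|k]; last first.
  by apply: L1_sum => l; apply: L1_indepM; [exact: HH1|exact: dd1|exact: Hd].
apply: eq_bigr => k _; rewrite mean_sum => [|l]; last first.
  by apply: L1_indepM; [exact: HH1|exact: dd1|exact: Hd].
apply: eq_bigr => l _.
have kn := ltn_ord k; have lm := ltn_ord l.
rewrite (mean_indepM (HH1 _ _ kn lm) (dd1 _ _ kn lm) (Hd _ _ kn lm)).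
rewrite (bm_covariance bZ ZW Da) ?t0 //; last 4 first.
- exact/Dt/ltnW.
- exact/Du/ltnW.
- exact/at_/ltnW.
- exact/au/ltnW.
congr (_ * _); apply: (bm_incr_overlap bW WZ Da); by
  [exact: Dt|exact/Dt/ltnW|exact: Du|exact/Du/ltnW|exact: at_|exact/at_/ltnW|exact: au|exact/au/ltnW].
Qed.

(** The three second moments are those of [partition_distance]. *)
Lemma riemann_distance t u n m : is_partition t n -> is_partition u m ->
  L2 P (fun w => riemann t n w - riemann u m w) /\
  mean P (fun w => (riemann t n w - riemann u m w) ^+ 2) <=
  \sum_(k < n) (t k.+1 - t k) ^+ 2 + \sum_(l < m) (u l.+1 - u l) ^+ 2.
Proof.
move=> pt pu; have [J2 JE] := riemann_isometry pt.
have [K2 KE] := riemann_isometry pu; have [JK1 JKE] := riemann_cross pt pu.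
split; first exact: L2B.
rewrite (_ : mean P _ = mean P (fun w => riemann t n w ^+ 2 + riemann u m w ^+ 2 -
    2 * (riemann t n w * riemann u m w))); last first.
  by congr mean; apply/funext => w; ring.
have s1 : L1 P (fun w => riemann t n w ^+ 2 + riemann u m w ^+ 2).
  by apply: L1D; exact: L2_sqr.
rewrite meanB //; last exact: L1Z.
rewrite meanD ?meanZ //; [|exact: L2_sqr..].
rewrite JE KE JKE; case: pt pu => [t0 tn tS Dt] [u0 um uS Du].
by apply: partition_distance; rewrite ?t0 ?tn.
Qed.

End two_partitions.
End riemann_sums.

(** * Itô integrals as limits of Riemann sums *)

Section elementary_integrals.
Context {R : realType} {d : measure_display} {T : measurableType d}.
Variables (P : probability T R) (D : set R) (Z W : R -> {RV P >-> R}) (a b : R).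
Hypothesis pZW : planar_brownian_motion D Z W.
Hypothesis iD : is_interval D.
Hypotheses (Da : D a) (Db : D b).
Let F := planar_filtration D Z W.

Lemma elementary_partition phi : elementary P F a b phi ->
  is_partition D a b (knot phi) (steps phi).
Proof.
move=> [k0 kn kS _ _]; split=> // k kk.
have kle := partition_le kS.
apply: (iD Da Db); rewrite -{1}k0 -kn; apply/andP; split.
  by apply: kle; rewrite leq0n.
by apply: kle; rewrite kk leqnn.
Qed.

Lemma step_valE (phi : step_process R T) (u : R) (k : nat) w :
  (forall k, (k < steps phi)%N -> knot phi k < knot phi k.+1) ->
  (k < steps phi)%N -> knot phi k <= u < knot phi k.+1 ->
  step_val phi u w = coef phi k w.
Proof.
move=> kS kn /andP[ku uk]; have kle := partition_le kS.
rewrite /step_val (bigD1 (Ordinal kn)) //= big1 => [|j].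
  by rewrite indicE mem_set ?mulr1 ?addr0 //= in_itv /= ku.
rewrite -val_eqE /= => jk; rewrite indicE memNset ?mulr0 //= in_itv /= => /andP[ju uj].
have := ltn_ord j => jn.
case: (ltngtP j k) jk => // jk _.
  by have := kle j.+1 k; rewrite jk (ltnW kn) => /(_ isT); lra.
by have := kle k.+1 j; rewrite jk (ltnW jn) => /(_ isT); lra.
Qed.

(** By the isometry [s] is the sum over the steps of E (c_k - H(t_k))^2 times the
    length of the step, and the time integral dominates it because the increment
    of [Z] inside a step is orthogonal to c_k - H(t_k). *)
Lemma elementary_bounds phi : elementary P F a b phi ->
  let t := knot phi in let n := steps phi in
  exists s : R, [/\ L2 P (fun w => step_integral W phi w - riemann Z W t n w),
    mean P (fun w => (step_integral W phi w - riemann Z W t n w) ^+ 2) = s,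
    0 <= s &
    ((s + (\sum_(k < n) (t k.+1 - t k) ^+ 2) / 4)%:E <=
     \int[lebesgue_measure]_(u in `[a, b[)
       'E_P[(fun w => (step_val phi u w - (Z u w - Z a w)) ^+ 2)%R])%E].
Proof.
move=> ephi t n; have [t0 tn tS Dt] := elementary_partition ephi.
have [_ _ _ aphi phi2] := ephi.
have [bZ bW ZW] := pZW; have [_ _ WZ] := planar_brownian_motionC pZW.
rewrite -/t -/n in t0 tn tS Dt aphi phi2; have tle := partition_le tS.
have Fm k : (k <= n)%N -> F (t k) `<=` measurable.
  move=> kn; apply: subset_trans (planar_filtration_sub (Dt _ kn)) _.
  exact: joint_past_measurable.
have c2 k : (k < n)%N -> L2 P (coef phi k).
  move=> kn; have mc : measurable_fun setT (coef phi k).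
    by apply: (adapted_measurable (Fm _ (ltnW kn))) => B mB; exact: aphi.
  split=> //; apply: ge0_L1; first exact: measurable_funX.
    by move=> w; exact: sqr_ge0.
  exact: phi2.
pose Q k w := coef phi k w - (Z (t k) w - Z a w).
have at_ k : (k <= n)%N -> a <= t k by move=> kn; rewrite -t0 tle // leq0n.
have Q2 k : (k < n)%N -> L2 P (Q k).
  move=> kn; apply: L2B; first exact: c2.
  by have [] := bm_incr bZ Da (Dt _ (ltnW kn)) (at_ _ (ltnW kn)).
have aQZ k : (k < n)%N -> adapted (joint_past D Z W (t k)) (Q k).
  move=> kn; have Dk := Dt _ (ltnW kn); apply: adapted_subr.
    by move=> B mB; apply: (planar_filtration_sub Dk); exact: aphi.
  by apply: adapted_subr; apply: adapted_bm => //; exact/at_/ltnW.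
have aQW k : (k < n)%N -> adapted (joint_past D W Z (t k)) (Q k).
  move=> kn; have Dk := Dt _ (ltnW kn); apply: adapted_subr.
    move=> B mB; apply: (planar_filtration_sub Dk); rewrite planar_filtrationC.
    exact: aphi.
  by apply: adapted_subr; apply: adapted_bm_snd.
have [_ J2 JE] := ito_isometry bW WZ Dt tS aQW Q2.
have SJ : (fun w => step_integral W phi w - riemann Z W t n w) =
    fun w => \sum_(k < n) Q k w * (W (t k.+1) w - W (t k) w).
  apply/funext => w; rewrite /step_integral /riemann /path_sum -sumrB.
  by apply: eq_bigr => k _; rewrite /Q -mulrBl t0.
exists (\sum_(k < n) mean P (fun w => Q k w ^+ 2) * (t k.+1 - t k)).
have e0 k : 0 <= mean P (fun w => Q k w ^+ 2).
  by apply: mean_ge0 => w; exact: sqr_ge0.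
split; [by rewrite SJ| |by apply: sumr_ge0 => k _; rewrite mulr_ge0 // subr_ge0 ltW // tS|].
  rewrite -JE; congr mean; apply/funext => w; congr (_ ^+ 2).
  exact: (congr1 (fun f => f w) SJ).
have [k kn u /andP[tu ut]|_ [_ [_]]] := @integral_partition_ge R t (fun k => mean P (fun w => Q k w ^+ 2))
  (fun u => 'E_P[(fun w => (step_val phi u w - (Z u w - Z a w)) ^+ 2)%R])%E n tS
  (fun k _ => e0 k); last by rewrite t0 tn big_split /= mulr_suml.
have Dk := Dt _ (ltnW kn).
have Du : D u.
  apply: (iD Dk (Dt _ kn)); by rewrite tu ltW.
under eq_fun do rewrite (@step_valE phi u k _ tS kn) ?tu //.
pose V w := Z u w - Z (t k) w.
have [V2 V0 Vv] := bm_incr bZ Dk Du tu; rewrite -/V in V2 V0 Vv.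
have QV0 : mean P (fun w => Q k w * V w) = 0.
  move: tu; rewrite le_eqVlt => /predU1P[tu|tu].
    rewrite -[RHS](mean_cst P 0); congr mean; apply/funext => w.
    by rewrite /V tu subrr mulr0.
  have iQV : indep_rv P (Q k) V.
    exact: indep_of_rv (indep_joint_past bZ ZW Dk Du tu) (aQZ _ kn).
  by rewrite (mean_indepM (L2_L1 (Q2 _ kn)) (L2_L1 V2) iQV) V0 mulr0.
have QV1 := L2M (Q2 _ kn) V2.
have QV2 := L2B (Q2 _ kn) V2.
transitivity ('E_P[(fun w => (Q k w - V w) ^+ 2)%R])%E.
  by congr ('E_P[_])%E; apply/funext => w; rewrite /Q /V; congr (_ ^+ 2); ring.
rewrite expectation_mean; last exact: L2_sqr.
congr EFin; rewrite -Vv.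
transitivity (mean P (fun w => Q k w ^+ 2 + V w ^+ 2 - 2 * (Q k w * V w))).
  by congr mean; apply/funext => w; ring.
have Qs := L2_sqr (Q2 _ kn); have Vs := L2_sqr V2.
by rewrite meanB ?meanD ?meanZ ?QV0 ?mulr0 ?subr0 //; [exact: L1D|exact: L1Z].
Qed.

(** The integral of phi_n is close to its limit, to the Riemann sum with its own
    knots, and that one to the given Riemann sum; the contributions of phi_n
    disappear as n grows. *)
Lemma ito_riemann_distance (I : {RV P >-> R}) u m :
  is_ito_integral F W a b (fun t w => Z t w - Z a w) I ->
  is_partition D a b u m ->
  L2 P (fun w => I w - riemann Z W u m w) /\
  mean P (fun w => (I w - riemann Z W u m w) ^+ 2) <=
  3 * \sum_(l < m) (u l.+1 - u l) ^+ 2.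
Proof.
move=> [phi [ephi cvH cvI]] pu.
set q := \sum_(l < m) _.
suff H eps : 0 < eps -> L2 P (fun w => I w - riemann Z W u m w) /\
    mean P (fun w => (I w - riemann Z W u m w) ^+ 2) <= 3 * q + 18 * eps.
  split; first by have [] := H 1 ltr01.
  apply/ler_addgt0Pr => e e0.
  have [|_ le] := H (e / 18); first by rewrite divr_gt0.
  by apply: le_trans le _; rewrite lerD2l; lra.
move=> eps0.
have e0 : (0 < eps%:E)%E by rewrite lte_fin.
have [n [n1 n2]] : exists n,
    ('E_P[(fun w => (step_integral W (phi n) w - I w) ^+ 2)%R] < eps%:E)%E /\
    (\int[lebesgue_measure]_(t in `[a, b[)
      'E_P[(fun w => (step_val (phi n) t w - (Z t w - Z a w)) ^+ 2)%R] < eps%:E)%E.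
  have [N1 _ H1] := cvI _ (open_ereal_lt' e0).
  have [N2 _ H2] := cvH _ (open_ereal_lt' e0).
  exists (maxn N1 N2); split; first by apply: H1; exact: leq_maxl.
  by apply: H2; exact: leq_maxr.
have [s [SJ2 SJE s0 sI]] := elementary_bounds (ephi n).
set t := knot (phi n) in SJ2 SJE sI; set N := steps (phi n) in SJ2 SJE sI.
have pt : is_partition D a b t N := elementary_partition (ephi n).
have [JK2 JKle] := riemann_distance pZW pt pu.
have q0 : 0 <= \sum_(k < N) (t k.+1 - t k) ^+ 2.
  by apply: sumr_ge0 => k _; exact: sqr_ge0.
have sq : s + (\sum_(k < N) (t k.+1 - t k) ^+ 2) / 4 <= eps.
  by rewrite -lee_fin; apply: le_trans sI (ltW n2).
have mS : measurable_fun setT (step_integral W (phi n)).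
  have := L2_measurable SJ2; have := L2_measurable (riemann_isometry pZW pt).1.
  move=> m1 m2; have := measurable_funD m2 m1.
  by congr measurable_fun; apply/funext => w; rewrite /= subrK.
have SI2 : L2 P (fun w => step_integral W (phi n) w - I w).
  split; first exact: measurable_funB.
  apply: ge0_L1; first by apply: measurable_funX; exact: measurable_funB.
    by move=> w; exact: sqr_ge0.
  by apply: lt_trans n1 _; rewrite ltry.
have SIle : mean P (fun w => (step_integral W (phi n) w - I w) ^+ 2) <= eps.
  by rewrite -lee_fin -expectation_mean ?ltW //; exact: L2_sqr.
have IJE : (fun w => I w - riemann Z W u m w) = fun w =>
    (step_integral W (phi n) w - riemann Z W t N w) +
    (riemann Z W t N w - riemann Z W u m w) - (step_integral W (phi n) w - I w).
  by apply/funext => w; ring.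
have IJ2 : L2 P (fun w => I w - riemann Z W u m w).
  by rewrite IJE; apply: L2B => //; exact: L2D.
split=> //.
apply: (@le_trans _ _ (mean P (fun w =>
    3 * (step_integral W (phi n) w - riemann Z W t N w) ^+ 2 +
    3 * (riemann Z W t N w - riemann Z W u m w) ^+ 2 +
    3 * (step_integral W (phi n) w - I w) ^+ 2))).
  apply: le_mean.
  - exact: L2_sqr.
  - by apply: L1D; [apply: L1D|]; apply: L1Z; exact: L2_sqr.
  - move=> w; have := congr1 (fun f => f w) IJE => /= ->.
    set x := step_integral W (phi n) w - riemann Z W t N w.
    set y := riemann Z W t N w - riemann Z W u m w.
    set z := step_integral W (phi n) w - I w.
    rewrite -subr_ge0 [leRHS](_ : _ = (x - y) ^+ 2 + (x + z) ^+ 2 + (y + z) ^+ 2).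
      by rewrite !addr_ge0 ?sqr_ge0.
    by ring.
rewrite meanD; [|by apply: L1D; apply: L1Z; exact: L2_sqr|by apply: L1Z; exact: L2_sqr].
rewrite meanD; [|by apply: L1Z; exact: L2_sqr..].
rewrite !meanZ; [|exact: L2_sqr..].
rewrite SJE; move: JKle SIle; rewrite -/q; lra.
Qed.

End elementary_integrals.

(** * Convergence of moments along L2-convergent sequences *)

Section moment_limit.
Context {R : realType} {d : measure_display} {T : measurableType d}.
Variables (P : probability T R) (f : T -> R) (g : nat -> T -> R) (eps : nat -> R).
Hypothesis mf : measurable_fun setT f.
Hypothesis mg : forall n, measurable_fun setT (g n).
Hypothesis fg2 : forall n, L2 P (fun w => f w - g n w).
Hypothesis fgE : forall n, mean P (fun w => (f w - g n w) ^+ 2) <= eps n.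
Hypothesis eps0 : eps n @[n --> \oo] --> 0.

Lemma min_expR_le (K u v : R) : 0 < K ->
  Num.min (expR u) K <= expR v + K * `|u - v|.
Proof.
move=> K0.
case: (lerP u v) => uv.
  rewrite ge_min; apply/orP; left; rewrite -[leLHS]addr0.
  by apply: lerD; [rewrite ler_expR|rewrite mulr_ge0 ?subr_ge0 // ltW].
set m := Num.min _ _.
have m0 : 0 < m by rewrite lt_min expR_gt0.
have mK : m <= K by rewrite ge_min lexx orbT.
have mu : m <= expR u by rewrite ge_min lexx.
have h := expR_ge1Dx (v - u).
have e : expR v = expR u * expR (v - u) by rewrite -expRD; congr expR; ring.
have h2 : m * (1 + (v - u)) <= expR v.
  rewrite e; apply: (@le_trans _ _ (m * expR (v - u))); first by rewrite ler_wpM2l // ltW.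
  by rewrite ler_wpM2r // expR_ge0.
have : m * (u - v) <= K * (u - v) by rewrite ler_wpM2r // subr_ge0 ltW.
lra.
Qed.

Lemma norm_le_sqr (x eta : R) : 0 < eta -> `|x| <= x ^+ 2 / eta + eta.
Proof.
move=> e0; rewrite -(ler_pM2r e0) mulrDl divfK ?gt_eqF // -(real_normK (num_real x)).
have := sqr_ge0 (`|x| - eta); have : 0 <= `|x| by [].
nra.
Qed.

(** Fatou's lemma for convergence in L2, without extracting an almost surely
    convergent subsequence: truncations of exp are Lipschitz. *)
Lemma expectation_exp_limit z C :
  (forall n, 'E_P[(fun w => expR (z * g n w))%R] <= C%:E)%E ->
  ('E_P[(fun w => expR (z * f w))%R] <= C%:E)%E.
Proof.
move=> gC.
have mzf : measurable_fun setT (fun w => expR (z * f w)).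
  by apply: measurableT_comp => //; exact: measurable_funM.
pose h (k : nat) w := Num.min (expR (z * f w)) k.+1%:R.
have mh k : measurable_fun setT (h k) by exact: measurable_minr.
have h0 k w : 0 <= h k w by rewrite le_min expR_ge0 ler0n.
have hC k : ('E_P[h k] <= C%:E)%E.
  set K : R := k.+1%:R; have K0 : 0 < K by rewrite ltr0n.
  have h1 : L1 P (h k).
    apply: (L1_dominated (mh k) _ (L1_cst P K)) => w.
    by rewrite ger0_norm // ge_min lexx orbT.
  rewrite expectation_mean // lee_fin; apply/ler_addgt0Pr => e e0.
  pose eta := e / (2 * K).
  have eta0 : 0 < eta by rewrite divr_gt0 // mulr_gt0.
  have [n en] : exists n, K * (z ^+ 2 * eps n / eta) <= e / 2.
    have : K * (z ^+ 2 * eps n / eta) @[n --> \oo] --> K * (z ^+ 2 * 0 / eta).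
      apply: cvgM; first exact: cvg_cst.
      apply: cvgM; last exact: cvg_cst.
      by apply: cvgM; [exact: cvg_cst|exact: eps0].
    rewrite mulr0 mul0r mulr0 => /cvgr0_norm_le /(_ (e / 2)).
    rewrite divr_gt0 // => /(_ isT) [n _ /(_ n (leqnn n))] /= H.
    by exists n; exact: le_trans (ler_norm _) H.
  have eg1 : L1 P (fun w => expR (z * g n w)).
    apply: ge0_L1.
    - by apply: measurableT_comp => //; exact: measurable_funM.
    - by move=> w; exact: expR_ge0.
    - by apply: le_lt_trans (gC n) _; rewrite ltry.
  have egC : mean P (fun w => expR (z * g n w)) <= C.
    by rewrite -lee_fin -expectation_mean.
  have s2 := L2_sqr (fg2 n).
  have s3 : L1 P (fun w => K * (z ^+ 2 / eta * (f w - g n w) ^+ 2 + eta)).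
    by apply: L1Z; apply: L1D; [exact: L1Z|exact: L1_cst].
  apply: (@le_trans _ _ (mean P (fun w => expR (z * g n w) +
      K * (z ^+ 2 / eta * (f w - g n w) ^+ 2 + eta)))).
    apply: le_mean => //; first exact: L1D.
    move=> w; apply: le_trans (min_expR_le (z * f w) (z * g n w) K0) _.
    rewrite lerD2l ler_pM2l // -mulrBr.
    apply: le_trans (norm_le_sqr _ eta0) _.
    by rewrite exprMn [leLHS]addrC [leRHS]addrC lerD2l mulrAC.
  have a1 := L1Z (z ^+ 2 / eta) s2.
  rewrite (meanD eg1 s3) (meanZ K (L1D a1 (L1_cst P eta))).
  rewrite (meanD a1 (L1_cst P eta)) (meanZ _ s2) mean_cst; apply: lerD => //.
  rewrite mulrDr [leRHS](splitr e); apply: lerD; last first.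
    by rewrite le_eqVlt; apply/orP; left; apply/eqP; rewrite /eta; field; rewrite gt_eqF.
  apply: le_trans en; rewrite ler_pM2l // mulrAC ler_pM2r ?invr_gt0 //.
  by rewrite ler_wpM2l ?sqr_ge0.
have cvh : ('E_P[h k] @[k --> \oo] --> 'E_P[(fun w => expR (z * f w))%R])%E.
  rewrite unlock.
  rewrite (eq_integral (fun w => limn (fun k => (h k w)%:E))); last first.
    move=> w _; apply/esym/cvg_lim => //; apply: cvg_near_cst.
    near=> k; rewrite /h min_l //.
    apply: (@le_trans _ _ k%:R); last by rewrite ler_nat.
    by near: k; exact: nbhs_infty_ger.
  apply: cvg_monotone_convergence => //.
  - by move=> k; exact/measurable_EFinP.
  - by move=> k w _; rewrite lee_fin.
  - move=> w _ i j ij; rewrite lee_fin le_min ge_min lexx /= ge_min.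
    by rewrite ler_nat ltnS ij orbT.
apply: cvge_le cvh.
by apply: nearW => k; exact: hC.
Unshelve. all: by end_near. Qed.

Lemma norm_subrX_le (c x y : R) k : 0 < c ->
  `|x ^+ k - y ^+ k| <= k%:R * (k.-1`!%:R / c ^+ k.-1) * `|x - y| *
    (expR (c * `|x|) + expR (c * `|y|)).
Proof.
move=> c0; rewrite subrXX normrM mulrC.
set B := k.-1`!%:R / c ^+ k.-1; set E := expR (c * `|x|) + _.
have BE : Num.max `|x| `|y| ^+ k.-1 <= B * E.
  have B0 : 0 <= B by rewrite divr_ge0 ?exprn_ge0 // ltW.
  case: (lerP `|x| `|y|) => xy.
    apply: le_trans (pow_le_exp k.-1 y c0) _.
    by apply: ler_wpM2l => //; rewrite /E lerDr expR_ge0.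
  apply: le_trans (pow_le_exp k.-1 x c0) _.
  by apply: ler_wpM2l => //; rewrite /E lerDl expR_ge0.
apply: (@le_trans _ _ ((k%:R * (B * E)) * `|x - y|)); last first.
  by rewrite le_eqVlt; apply/orP; left; apply/eqP; ring.
rewrite ler_wpM2r //; apply: le_trans (ler_norm_sum _ _ _) _.
rewrite -[k in k%:R]card_ord -sum1_card natr_sum mulr_suml.
apply: ler_sum => i _; rewrite mul1r; apply: le_trans BE.
have ki : (k.-1 = (k.-1 - i) + i)%N by have := ltn_ord i; lia.
rewrite [in leRHS]ki exprD normrM !normrX.
by apply: ler_pM; rewrite ?exprn_ge0 //; apply: lerXn2r;
  rewrite ?nnegrE ?le_max ?lexx ?orbT ?normr_ge0.
Qed.

(** A difference of powers is |x - y| times a function with bounded second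
    moment; weighting the two factors by a small eta replaces the inequality of
    Cauchy and Schwarz. *)
Lemma mean_pow_limit (c C : R) k : 0 < c ->
  L1 P (fun w => expR (c * `|f w|)) -> mean P (fun w => expR (c * `|f w|)) <= C ->
  (forall n, L1 P (fun w => expR (c * `|g n w|)) /\
    mean P (fun w => expR (c * `|g n w|)) <= C) ->
  mean P (fun w => g n w ^+ k) @[n --> \oo] --> mean P (fun w => f w ^+ k).
Proof.
move=> c0 f1 fC gC.
have c20 : 0 < c / 2 by rewrite divr_gt0.
pose B := k%:R * (k.-1`!%:R / (c / 2) ^+ k.-1).
have B0 : 0 <= B by rewrite mulr_ge0 // divr_ge0 ?exprn_ge0 // ltW.
have C0 : 0 <= C by apply: le_trans fC; apply: mean_ge0 => w; exact: expR_ge0.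
have key eta n : 0 < eta ->
    `|mean P (fun w => f w ^+ k) - mean P (fun w => g n w ^+ k)| <=
    eps n / eta + eta * (4 * B ^+ 2 * C).
  move=> eta0; have [g1 gCn] := gC n.
  have fk := L1_pow mf c0 f1 k; have gk := L1_pow (mg n) c0 g1 k.
  rewrite -meanB //; apply: le_trans (le_normr_Rintegral measurableT (L1B fk gk)) _.
  have s2 := L2_sqr (fg2 n).
  have e1 := L1D f1 g1.
  have t1 := L1Z eta^-1 s2; have t2 := L1Z (eta * (2 * B ^+ 2)) e1.
  apply: (@le_trans _ _ (mean P (fun w => eta^-1 * (f w - g n w) ^+ 2 +
      eta * (2 * B ^+ 2) * (expR (c * `|f w|) + expR (c * `|g n w|))))).
    apply: le_mean => //; [exact: integrable_norm (L1B fk gk)|exact: L1D|].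
    move=> w; apply: le_trans (norm_subrX_le (f w) (g n w) k c20) _.
    rewrite -/B; set x := f w; set y := g n w.
    have sqe u : expR (c * u) = expR (c / 2 * u) ^+ 2.
      by rewrite -expRM_natl; congr expR; field.
    rewrite !sqe; set ex := expR _; set ey := expR _.
    have ab (p q : R) : 0 <= p -> 0 <= q -> p * q <= eta^-1 * p ^+ 2 + eta * q ^+ 2.
      move=> p0 q0; rewrite -(ler_pM2l eta0).
      rewrite [leRHS](_ : _ = p ^+ 2 + (eta * q) ^+ 2); last by field; rewrite gt_eqF.
      rewrite mulrCA; have := mulr_ge0 (ltW eta0) q0; move: (eta * q) => m m0.
      by have := sqr_ge0 (p - m); nra.
    rewrite mulrAC [leLHS]mulrC.
    apply: le_trans (ab _ _ (normr_ge0 _) _) _.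
      by rewrite mulr_ge0 // addr_ge0 // expR_ge0.
    rewrite (real_normK (num_real _)) lerD2l -[leRHS]mulrA ler_pM2l // exprMn.
    have h : (ex + ey) ^+ 2 <= 2 * (ex ^+ 2 + ey ^+ 2).
      by have := sqr_ge0 (ex - ey); nra.
    by have := ler_wpM2l (sqr_ge0 B) h; lra.
  rewrite (meanD t1 t2) (meanZ _ s2) (meanZ _ e1) (meanD f1 g1).
  apply: lerD; first by rewrite mulrC ler_pM2r ?invr_gt0.
  rewrite -[leLHS]mulrA ler_pM2l //.
  apply: (@le_trans _ _ (2 * B ^+ 2 * (C + C))).
    by apply: ler_wpM2l; [rewrite mulr_ge0 ?sqr_ge0|exact: lerD].
  by rewrite le_eqVlt; apply/orP; left; apply/eqP; ring.
set K := 4 * B ^+ 2 * C in key.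
have K0 : 0 <= K by apply: mulr_ge0 => //; apply: mulr_ge0 => //; exact: sqr_ge0.
apply/cvgrPdist_le => e e0.
pose eta := e / (2 * (K + 1)).
have K1 : 0 < K + 1 by rewrite ltr_wpDl.
have eta0 : 0 < eta by rewrite divr_gt0 // mulr_gt0.
have /cvgr0_norm_le /(_ (e / 2)) : eps n / eta @[n --> \oo] --> 0.
  by rewrite -[0](mul0r eta^-1); apply: cvgM; [exact: eps0|exact: cvg_cst].
rewrite divr_gt0 // => /(_ isT) near_e.
near=> n.
apply: le_trans (key eta n eta0) _; rewrite [leRHS](splitr e); apply: lerD.
  by apply: le_trans (ler_norm _) _; near: n.
rewrite /eta mulrAC ler_pdivrMr ?mulr_gt0 //.
have -> : e / 2 * (2 * (K + 1)) = e * (K + 1) by field.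
by rewrite ler_pM2l // lerDl.
Unshelve. all: by end_near. Qed.

End moment_limit.

(** * The formal inverse of the cosine *)

Section convolution.
Context {R : realType}.

(** The falling factorial is asymptotic to the power. *)
Lemma cvg_bin_pow (h : R) j :
  'C(n.+1, j)%:R * (h / n.+1%:R) ^+ j @[n --> \oo] --> h ^+ j / j`!%:R.
Proof.
have F : (n.+1 ^_ j)%:R / n.+1%:R ^+ j @[n --> \oo] --> (1 : R).
  elim: j => [|j IH].
    by under eq_fun do rewrite ffactn0 expr0 divr1; exact: cvg_cst.
  have q : (n.+1 - j)%:R / n.+1%:R @[n --> \oo] --> (1 : R).
    apply: (@cvg_trans _ ((1 - j%:R * harmonic n) @[n --> \oo])).
      apply: near_eq_cvg; near=> n.
      have jn : (j <= n.+1)%N by apply: leqW; near: n; exact: nbhs_infty_ge.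
      by rewrite natrB // mulrBl divff // pnatr_eq0.
    have c : 1 - j%:R * harmonic n @[n --> \oo] --> (1 - j%:R * 0 : R).
      apply: cvgB; first exact: cvg_cst.
      by apply: cvgM; [exact: cvg_cst|exact: cvg_harmonic].
    by move: c; rewrite mulr0 subr0.
  under eq_fun do rewrite ffactnSr natrM exprSr invfM mulrACA.
  have c : (n.+1 ^_ j)%:R / n.+1%:R ^+ j * ((n.+1 - j)%:R / n.+1%:R)
    @[n --> \oo] --> (1 * 1 : R) by exact: cvgM.
  by move: c; rewrite mulr1.
have E n : 'C(n.+1, j)%:R * (h / n.+1%:R) ^+ j =
    (h ^+ j / j`!%:R) * ((n.+1 ^_ j)%:R / n.+1%:R ^+ j).
  rewrite -bin_ffact natrM expr_div_n.
  by field; rewrite expf_neq0 ?pnatr_eq0 // -lt0n fact_gt0.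
under eq_fun do rewrite E.
have c : h ^+ j / j`!%:R * ((n.+1 ^_ j)%:R / n.+1%:R ^+ j) @[n --> \oo] -->
    h ^+ j / j`!%:R * 1 by apply: cvgM; [exact: cvg_cst|].
by move: c; rewrite mulr1.
Unshelve. all: by end_near. Qed.

(** Taylor coefficients of [cos (h z)] and [1 / cos (h z)]; that the second is
    right is the content of [sec_cos_convolution]. *)
Definition cos_coef (h : R) j := cos_sign j * (h ^+ j / j`!%:R).

Definition sec_coef (h : R) i : R :=
  if odd i then 0 else h ^+ i * (euler_zigzag i)%:R / i`!%:R.

(** [sech_cosh] with the signs of [sech_coef] moved from the zigzag numbers to the
    cosine. *)
Lemma sec_cos_convolution h k :
  \sum_(i < k.+1) sec_coef h i * cos_coef h (k - i) = (k == 0%N)%:R.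
Proof.
case: (boolP (odd k)) => ok.
  rewrite big1 => [|i _]; first by case: k ok.
  rewrite /sec_coef /cos_coef /cos_sign; case: ifP => oi; first by rewrite mul0r.
  have ik : (i <= k)%N by rewrite -ltnS.
  by rewrite (oddB ik) ok oi /= mul0r mulr0.
have := congr1 (fun z : int => z%:~R : R) (sech_cosh ok).
rewrite rmorph_sum /= => H.
have k0 : k`!%:R != 0 :> R by rewrite pnatr_eq0 -lt0n fact_gt0.
transitivity (h ^+ k * (-1) ^+ k./2 / k`!%:R * ((k == 0%N)%:Z%:~R)); last first.
  case: (k) => [|k'] /=; last by rewrite mulr0.
  by rewrite fact0 !expr0 !mul1r invr1 mulr1.
rewrite -H mulr_sumr; apply: eq_bigr => i _; have ik : (i <= k)%N by rewrite -ltnS.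
rewrite rmorphM /= /sec_coef /cos_coef /cos_sign /sech_coef.
case: (boolP (odd i)) => oi; first by rewrite mul0r rmorph0 !mulr0.
rewrite oddB // (negbTE ok) (negbTE oi) /=.
have bf : 'C(k, i)%:R = k`!%:R / (i`!%:R * (k - i)`!%:R) :> R.
  rewrite -(bin_fact ik) !natrM mulfK // mulf_neq0 //; by rewrite pnatr_eq0 -lt0n fact_gt0.
have s : (-1) ^+ k./2 = (-1) ^+ (k - i)./2 * (-1) ^+ i./2 :> R.
  rewrite -exprD; congr (_ ^+ _).
  by have := ok; have := oi; lia.
have hk : h ^+ k = h ^+ i * h ^+ (k - i) by rewrite -exprD subnKC.
rewrite rmorphM /= rmorphXn /= rmorphN rmorph1 !pmulrn -!pmulrn bf s hk.
have i0 : i`!%:R != 0 :> R by rewrite pnatr_eq0 -lt0n fact_gt0.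
have ki0 : (k - i)`!%:R != 0 :> R by rewrite pnatr_eq0 -lt0n fact_gt0.
have ss : (-1) ^+ i./2 * (-1) ^+ i./2 = 1 :> R by rewrite -expr2 sqrr_sign.
rewrite [RHS](_ : _ = ((-1) ^+ i./2 * (-1) ^+ i./2) *
  (h ^+ i * (euler_zigzag i)%:R / i`!%:R * ((-1) ^+ (k - i)./2 * (h ^+ (k - i) / (k - i)`!%:R)))).
  by rewrite ss mul1r.
by field; rewrite k0 i0 ki0.
Qed.

Lemma convolution_inverse_unique (h : R) (mu : nat -> R) :
  (forall k, \sum_(i < k.+1) mu i * cos_coef h (k - i) = (k == 0%N)%:R) ->
  forall k, mu k = sec_coef h k.
Proof.
move=> muE; elim/ltn_ind => k IH.
have := muE k; rewrite -(sec_cos_convolution h k) !big_ord_recr /= subnn.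
have -> : cos_coef h 0 = 1 by rewrite /cos_coef /cos_sign /= expr0 fact0 divr1 mulr1.
rewrite !mulr1 (eq_bigr (fun i : 'I_k => sec_coef h i * cos_coef h (k - i))).
  by move/addrI.
by move=> i _; rewrite IH.
Qed.

End convolution.

(** * Moments of the Lévy area *)

Section levy_area.
Context {R : realType} {d : measure_display} {T : measurableType d}.
Variables (P : probability T R) (D : set R) (X Y : R -> {RV P >-> R}) (a b : R).
Hypothesis iD : is_interval D.
Hypothesis pXY : planar_brownian_motion D X Y.
Hypotheses (Da : D a) (Db : D b) (ab : a < b).

Definition mesh n : R := (b - a) / n.+1%:R.
Definition uniform_knot n i : R := a + i%:R * mesh n.

Lemma mesh_gt0 n : 0 < mesh n.
Proof. by rewrite divr_gt0 ?subr_gt0. Qed.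

Lemma uniform_knotS n i : uniform_knot n i.+1 = uniform_knot n i + mesh n.
Proof. by rewrite /uniform_knot -natr1; ring. Qed.

Lemma uniform_partition n : is_partition D a b (uniform_knot n) n.+1.
Proof.
have e : uniform_knot n n.+1 = b.
  by rewrite /uniform_knot /mesh mulrCA divff ?pnatr_eq0 // mulr1 addrC subrK.
split=> //.
- by rewrite /uniform_knot mul0r addr0.
- by move=> k _; rewrite uniform_knotS ltrDl mesh_gt0.
- move=> k kn; apply: (iD Da Db); have h := ltW (mesh_gt0 n).
  apply/andP; split; first by rewrite /uniform_knot lerDl mulr_ge0.
  by rewrite -e /uniform_knot lerD2l ler_wpM2r // ler_nat.
Qed.

Lemma uniform_quadratic_size n :
  \sum_(l < n.+1) (uniform_knot n l.+1 - uniform_knot n l) ^+ 2 =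
  (b - a) ^+ 2 / n.+1%:R.
Proof.
rewrite (eq_bigr (fun=> mesh n ^+ 2)) => [|l _].
  rewrite sumr_const card_ord -[LHS]mulr_natl /mesh expr_div_n mulrCA; congr (_ * _).
  by rewrite expr2 invfM mulrA mulfV ?mul1r // pnatr_eq0.
by rewrite uniform_knotS addrAC subrr add0r.
Qed.

Variables IXdY IYdX : {RV P >-> R}.
Hypothesis iXdY : is_ito_integral (planar_filtration D X Y) Y a b
  (fun t w => X t w - X a w) IXdY.
Hypothesis iYdX : is_ito_integral (planar_filtration D X Y) X a b
  (fun t w => Y t w - Y a w) IYdX.

Let A w := 2^-1 * (IXdY w - IYdX w).

Let An n w := path_area (fun i => X (uniform_knot n i) w)
  (fun i => Y (uniform_knot n i) w) n.+1.

Let eps n := 3 * ((b - a) ^+ 2 / n.+1%:R).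

Let mA : measurable_fun setT A.
Proof. by apply: measurable_funM => //; exact: measurable_funB. Qed.

Let mAn n : measurable_fun setT (An n).
Proof. by apply: measurable_path_area. Qed.

Lemma area_L2_error n : L2 P (fun w => A w - An n w) /\
  mean P (fun w => (A w - An n w) ^+ 2) <= eps n.
Proof.
have pYX := planar_brownian_motionC pXY.
have iYdX' : is_ito_integral (planar_filtration D Y X) X a b
    (fun t w => Y t w - Y a w) IYdX.
  by congr (is_ito_integral _) : iYdX; apply/funext => t; exact: planar_filtrationC.
have AE w : A w - An n w =
    2^-1 * ((IXdY w - riemann X Y (uniform_knot n) n.+1 w) -
            (IYdX w - riemann Y X (uniform_knot n) n.+1 w)).
  by rewrite /A /An /path_area /riemann; ring.
have [d1 e1] := ito_riemann_distance pXY iD Da Db iXdY (uniform_partition n).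
have [d2 e2] := ito_riemann_distance pYX iD Da Db iYdX' (uniform_partition n).
rewrite uniform_quadratic_size -/(eps n) in e1 e2.
have d3 : L2 P (fun w => A w - An n w).
  by have := L2Z 2^-1 (L2B d1 d2); congr L2; apply/funext => w; exact/esym/AE.
split=> //.
apply: (@le_trans _ _ (mean P (fun w => 2^-1 *
  ((IXdY w - riemann X Y (uniform_knot n) n.+1 w) ^+ 2 +
   (IYdX w - riemann Y X (uniform_knot n) n.+1 w) ^+ 2)))).
  apply: le_mean; [exact: L2_sqr|by apply: L1Z; apply: L1D; exact: L2_sqr|].
  move=> w; rewrite AE; set x := IXdY w - _; set y := IYdX w - _.
  by have := sqr_ge0 (x + y); nra.
rewrite meanZ ?meanD; [|by [exact: L2_sqr|apply: L1D; exact: L2_sqr]..].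
by lra.
Qed.

Let eps0 : eps n @[n --> \oo] --> 0.
Proof.
rewrite -[X in _ --> X](mulr0 3); apply: cvgM; first exact: cvg_cst.
rewrite -[X in _ --> X](mulr0 ((b - a) ^+ 2)).
by apply: cvgM; [exact: cvg_cst|exact: cvg_harmonic].
Qed.

(* The largest exponent for which the generating function of every [An n] is
   known to be at most 2. *)
Let z := (b - a)^-1.

Let z0 : 0 < z. Proof. by rewrite invr_gt0 subr_gt0. Qed.

Let zn n : n.+1%:R * (z * mesh n) = 1.
Proof.
by rewrite /z /mesh mulKf ?mulfV ?pnatr_eq0 // gt_eqF // subr_gt0.
Qed.

Let Dk n k : (k <= n.+1)%N -> D (uniform_knot n k).
Proof. by have [_ _ _] := uniform_partition n; apply. Qed.

Lemma exp_abs_area : L1 P (fun w => expR (z * `|A w|)) /\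
  mean P (fun w => expR (z * `|A w|)) <= 2 + 2.
Proof.
have le2 s : `|s| = z -> ('E_P[(fun w => expR (s * A w))%R] <= 2%:E)%E.
  move=> sz; apply: (expectation_exp_limit mA mAn (fun n => (area_L2_error n).1)
    (fun n => (area_L2_error n).2) eps0) => n.
  apply: (mgf_discrete_area_le2 pXY (mesh_gt0 n) (@Dk n) (uniform_knotS n)).
  by rewrite sz zn.
apply: exp_abs_le => //; first by apply: le2; rewrite gtr0_norm.
by under eq_fun do rewrite -mulNr; apply: le2; rewrite normrN gtr0_norm.
Qed.

Lemma mean_area_limit k :
  mean P (fun w => An n w ^+ k) @[n --> \oo] --> mean P (fun w => A w ^+ k).
Proof.
have [A1 A4] := exp_abs_area.
apply: (mean_pow_limit mA mAn (fun n => (area_L2_error n).1)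
  (fun n => (area_L2_error n).2) eps0 z0 A1 A4) => n.
apply: (exp_abs_discrete_area pXY (mesh_gt0 n) (@Dk n) (uniform_knotS n) z0).
by rewrite zn.
Qed.

(** The relations of [discrete_area_moments] converge term by term to those that
    characterise the coefficients of the secant. *)
Lemma levy_area_moments k : L1 P (fun w => A w ^+ k) /\
  mean P (fun w => A w ^+ k) = k`!%:R * sec_coef ((b - a) / 2) k.
Proof.
have [A1 _] := exp_abs_area; split; first exact: (L1_pow mA z0 A1).
have f0 : k`!%:R != 0 :> R by rewrite pnatr_eq0 -lt0n fact_gt0.
rewrite -(convolution_inverse_unique (mu := fun k => mean P (fun w => A w ^+ k) / k`!%:R)).
  by rewrite mulrC divfK.
move=> {f0}{}k.
have cv : \sum_(i < k.+1) (mean P (fun w => An n w ^+ i) / i`!%:R) *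
    (cos_sign (k - i) * 'C(n.+1, k - i)%:R * (mesh n / 2) ^+ (k - i)) @[n --> \oo] -->
    \sum_(i < k.+1) (mean P (fun w => A w ^+ i) / i`!%:R) * cos_coef ((b - a) / 2) (k - i).
  apply: cvg_big => [|i _]; first exact: add_continuous.
  apply: cvgM.
    by apply: cvgM; [exact: mean_area_limit|exact: cvg_cst].
  have E n : cos_sign (k - i) * 'C(n.+1, k - i)%:R * (mesh n / 2) ^+ (k - i) =
      cos_sign (k - i) * ('C(n.+1, k - i)%:R * ((b - a) / 2 / n.+1%:R) ^+ (k - i)) :> R.
    by rewrite mulrA /mesh [(b - a) / _ / _]mulrAC.
  under eq_fun do rewrite E.
  by apply: cvgM; [exact: cvg_cst|exact: cvg_bin_pow].
have : (k == 0%N)%:R @[n --> \oo] -->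
  \sum_(i < k.+1) (mean P (fun w => A w ^+ i) / i`!%:R) * cos_coef ((b - a) / 2) (k - i).
  by move: cv; under eq_fun do rewrite
    (discrete_area_moments pXY (mesh_gt0 _) (@Dk _) (uniform_knotS _)).
by move/(cvg_lim (@norm_hausdorff _ _)) => <-; rewrite lim_cst.
Qed.

End levy_area.

Theorem theorem7 (R : realType) (d : measure_display) (T : measurableType d)
    (P : probability T R) (D : set R) (X Y : R -> {RV P >-> R}) (a b : R)
    (A : {RV P >-> R}) :
  time_domain D ->
  planar_brownian_motion D X Y ->
  D a -> D b -> a < b ->
  is_levy_area D X Y a b A ->
  (forall n : nat, 'E_P[(fun w => (A w ^+ n)%R)]%E <> 0%E <-> ~~ odd n) /\
  (forall m : nat, 'E_P[(fun w => (A w ^+ (2 * m))%R)]%E =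
     (((b - a) / 2) ^+ (2 * m) * (euler_zigzag (2 * m))%:R)%:E).
Proof.
move=> [iD _ _] pXY Da Db ab [IXdY [IYdX [i1 i2 AE]]].
have M := levy_area_moments iD pXY Da Db ab i1 i2.
have EA n : ('E_P[(fun w => (A w ^+ n)%R)] =
    (n`!%:R * sec_coef ((b - a) / 2) n)%:E)%E.
  have [l1 <-] := M n; rewrite -expectation_mean // unlock.
  apply: ae_eq_integral => //.
  - by apply/measurable_EFinP; exact: measurable_funX.
  - by apply/measurable_EFinP; exact: L1_measurable l1.
  - by apply: filterS AE => w Aw _; rewrite Aw.
have f0 n : n`!%:R != 0 :> R by rewrite pnatr_eq0 -lt0n fact_gt0.
split=> [n|m]; rewrite EA /sec_coef.
  case: (odd n) => /=; split=> //; first by rewrite mulr0.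
  move=> _ [] /eqP; apply/negP; rewrite mulrC divfK // mulf_neq0 //.
    by rewrite expf_neq0 // gt_eqF // divr_gt0 // subr_gt0.
  by rewrite pnatr_eq0 -lt0n euler_zigzag_gt0.
by rewrite oddM /= mulrC divfK.
Qed.
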